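(* Let $T>0$ and let $f\in C^1(\mathbb{R}_+\times\mathbb{R}^n;\mathbb{R}^n)$ satisfy $f(t+T,x)=f(t,x)$ for all $t\ge 0$, $x\in\mathbb{R}^n$. Consider the system $\dot x(t)=f(t,x(t))$, $x(t)\in\mathbb{R}^n$, and let $\varphi(t,t_0,x_0)$ denote its solution at time $t\ge t_0$ with initial condition $x(t_0)=x_0$. Suppose that there exist a non-empty set $S\subseteq\mathbb{R}^n$ and a convex, compact set $C\subseteq\mathbb{R}^n$ such that for all $t_0\ge 0$, $x_0\in S$, there exists $\tau\ge t_0$ with $\varphi(t,t_0,x_0)\in C$ for all $t\ge\tau$. Moreover, suppose that there exists a $T$-periodic function $p\in C^0(\mathbb{R}_+;\mathbb{R})$ with $\int_0^T p(s)\,ds<0$ such that $\mu\left(\frac{\partial f}{\partial z}(t,z)\right)\le p(t)$ for all $t\ge 0$, $z\in C$, where $\mu(\cdot)$ denotes the logarithmic norm associated with a norm $|\cdot|$ of $\mathbb{R}^n$. Then there exists a unique $T$-periodic solution $x^*(t)$ of $\dot x(t)=f(t,x(t))$ with $x^*(t)\in C$ for all $t\in[0,T]$ such that $\lim_{t\to+\infty}\left(\left|\varphi(t,t_0,x_0)-x^*(t)\right|\right)=0$ for all $t_0\ge 0$, $x_0\in S$.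
   Context: $\mathbb{R}_+=[0,+\infty)$. $C^1(\mathbb{R}_+\times\mathbb{R}^n;\mathbb{R}^n)$ is the class of maps with continuous first-order derivatives in the interior of $\mathbb{R}_+\times\mathbb{R}^n$ that can be continued continuously to all of $\mathbb{R}_+\times\mathbb{R}^n$. For $t_0\ge 0$, $x_0\in\mathbb{R}^n$, $\varphi(t,t_0,x_0)$ is the unique (maximally extended forward in time) solution of $\dot x(t)=f(t,x(t))$ with $x(t_0)=x_0$; the condition ''$\varphi(t,t_0,x_0)\in C$ for all $t\ge\tau$'' includes that the solution exists for all $t\ge t_0$. $\frac{\partial f}{\partial z}(t,z)\in\mathbb{R}^{n\times n}$ is the Jacobian matrix of $f$ with respect to its second argument. For a norm $|\cdot|$ of $\mathbb{R}^n$, the induced matrix norm is $\|G\|:=\sup\{|Gx|:|x|\le 1\}$ for $G\in\mathbb{R}^{n\times n}$, and the associated logarithmic norm is $\mu(G):=\lim_{h\to 0^+}\frac{\|I_n+hG\|-1}{h}$, where $I_n$ is the $n\times n$ identity matrix. A $T$-periodic solution is a solution $x^*$ satisfying $x^*(t+T)=x^*(t)$ for all $t\ge 0$ (constant solutions are allowed). *)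

(* Defs.v *)
(* R^n is ['cV[R]_n] for [R : realType]. *)
From HB Require Import structures.
From mathcomp Require Import all_boot all_order all_algebra.
From mathcomp Require Import all_classical all_reals all_analysis.

Set Implicit Arguments.
Unset Strict Implicit.
Unset Printing Implicit Defensive.

Import Order.TTheory GRing.Theory Num.Theory.
Import numFieldNormedType.Exports.

Local Open Scope classical_set_scope.
Local Open Scope ring_scope.

(* An arbitrary norm of R^n, as opposed to the library's sup norm [`|x|]. *)
Definition is_norm (R : realType) (n : nat) (N : 'cV[R]_n -> R) : Prop :=
  [/\ forall x, 0 <= N x,
      forall x, N x = 0 -> x = 0,
      forall (a : R) x, N (a *: x) = `|a| * N x
    & forall x y, N (x + y) <= N x + N y].

Definition induced_norm (R : realType) (n : nat) (N : 'cV[R]_n -> R)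
    (G : 'M[R]_n) : R :=
  sup [set N (G *m x) | x in [set x | N x <= 1]].

Definition log_norm (R : realType) (n : nat) (N : 'cV[R]_n -> R)
    (G : 'M[R]_n) : R :=
  lim ((induced_norm N (1%:M + h *: G) - 1) / h @[h --> 0^'+]).

(* The library's [jacobian] is the transpose of this matrix: it acts on row
   vectors from the right. *)
Definition Jacobian (R : realType) (n : nat) (g : 'cV[R]_n -> 'cV[R]_n)
    (z : 'cV[R]_n) : 'M[R]_n :=
  \matrix_(i, j) 'D_(delta_mx j 0) (fun x => g x i 0) z.

(* The canonical basis of R x R^n: [None] is the time direction. *)
Definition time_space_basis (R : realType) (n : nat) (k : option 'I_n) :
    R * 'cV[R]_n :=
  if k is Some j then (0, delta_mx j 0) else (1, 0).

(* Only the values of [f] at times [t >= 0] matter: partial derivatives are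
   taken at interior points, and their continuous extensions to the closed
   domain are the maps [g]. *)
Definition C1_half_space (R : realType) (n : nat)
    (f : R -> 'cV[R]_n -> 'cV[R]_n) : Prop :=
  let F := fun q : R * 'cV[R]_n => f q.1 q.2 in
  let H := [set q : R * 'cV[R]_n | 0 <= q.1] in
  {within H, continuous F} /\
  forall k : option 'I_n, exists g : R * 'cV[R]_n -> 'cV[R]_n,
    {within H, continuous g} /\
    forall q, 0 < q.1 ->
      derivable F q (time_space_basis R k) /\
      'D_(time_space_basis R k) F q = g q.

(* [x' = f(t, x)] on [I]; the difference quotient is restricted to [I], so the
   derivative is one-sided at the endpoints of an interval. *)
Definition ode_solution (R : realType) (n : nat)
    (f : R -> 'cV[R]_n -> 'cV[R]_n) (I : set R) (x : R -> 'cV[R]_n) : Prop :=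
  forall t, I t ->
    (s - t)^-1 *: (x s - x t) @[s --> within I t^'] --> f t (x t).

(* The values at time [t] of the solutions on [[t0, t]] with [x t0 = x0].  For
   [f] of class C^1 and [0 <= t0] this set has at most one element, and it is
   non-empty exactly when [t] lies in the domain of the maximal forward
   solution. *)
Definition reached (R : realType) (n : nat) (f : R -> 'cV[R]_n -> 'cV[R]_n)
    (t t0 : R) (x0 : 'cV[R]_n) : set 'cV[R]_n :=
  [set y | exists x : R -> 'cV[R]_n,
     [/\ t0 <= t, ode_solution f `[t0, t] x, x t0 = x0 & x t = y]].

Definition flow_defined (R : realType) (n : nat)
    (f : R -> 'cV[R]_n -> 'cV[R]_n) (t t0 : R) (x0 : 'cV[R]_n) : Prop :=
  reached f t t0 x0 !=set0.

(* phi(t, t0, x0); the value is 0 outside [flow_defined]. *)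
Definition flow (R : realType) (n : nat) (f : R -> 'cV[R]_n -> 'cV[R]_n)
    (t t0 : R) (x0 : 'cV[R]_n) : 'cV[R]_n :=
  xget 0 (reached f t t0 x0).

Definition periodic_on_nneg (R : realType) (V : Type) (T : R) (x : R -> V) :
    Prop :=
  forall t, 0 <= t -> x (t + T) = x t.

Definition periodic_solution_in (R : realType) (n : nat)
    (f : R -> 'cV[R]_n -> 'cV[R]_n) (T : R) (C : set 'cV[R]_n)
    (x : R -> 'cV[R]_n) : Prop :=
  [/\ ode_solution f `[0, +oo[ x,
      periodic_on_nneg T x
    & forall t, 0 <= t <= T -> C (x t)].

(* Main.v *)
Require Import Defs.
From HB Require Import structures.
From mathcomp Require Import all_boot all_order all_algebra.
From mathcomp Require Import all_classical all_reals all_analysis.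
From mathcomp Require Import ring lra.

Set Implicit Arguments.
Unset Strict Implicit.
Unset Printing Implicit Defensive.

Import Order.TTheory GRing.Theory Num.Theory.
Import numFieldNormedType.Exports.

Local Open Scope classical_set_scope.
Local Open Scope ring_scope.

(** The proof rests on a contraction estimate for pairs of solutions that stay
    in [C].

    For a vector [d], the right derivative of [N] at [d] in a direction [w],
    written [norm_dir N d w], is a sublinear function of [w], and
    [norm_dir N d (G *m d) <= log_norm N G * N d] ([norm_dir_log_norm]).  If [x]
    and [y] lie in [C], the whole segment between them does, and a mean value
    inequality for sublinear functionals ([sublinear_mean_value]) applied to [f]
    along that segment turns the bound on the logarithmic norm of the Jacobian
    into
      [norm_dir N (x - y) (f t x - f t y) <= p t * N (x - y)]
    ([one_sided_lipschitz]).  So, for two solutions [z] and [w] that stay in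
    [C], the upper right derivative of [N (z t - w t)] is at most
    [p t * N (z t - w t)]; a Gronwall argument ([difference_gronwall]) shows that over one period the
    distance is multiplied by at most [c = exp (\int_0^T p) < 1]
    ([period_contraction]).  By periodicity of [f], a solution translated by a
    multiple of [T] is again a solution, so the estimate iterates and any two
    solutions that stay in [C] merge ([solutions_in_merge]).

    A trajectory issued from [S] eventually stays in [C]; after a translation by
    a multiple of [T] it is a solution [x] in [C] on [[0, +oo[].  Comparing [x]
    with its own translates [u k = x (_ + k T)] gives
    [N (u m t - u k t) <= M c ^ k diam C] for [k <= m], so [u k] converges
    uniformly on [[0, +oo[]; the limit is a solution, stays in the closed set
    [C], and is [T]-periodic because [u k (t + T) = u k.+1 t]
    ([periodic_limit]).  The trajectories from [S] merge with it, and it is the only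
    periodic solution in [C] because a periodic distance that tends to zero
    vanishes.

    Two preparations are required.  Continuity of the partial derivatives makes
    [f t] strictly differentiable in space, locally uniformly in [t]
    ([C1_strictly_differentiable]); this provides the derivative along segments
    and local Lipschitz bounds.  Uniqueness of solutions
    ([ode_solution_unique]) then shows that [flow], which picks a value at each
    time separately, is a single solution ([flow_solution]).

    Norms of differences of solutions have no derivative in general; their
    differential inequalities are about upper right Dini derivatives and all go
    through [dini_le]. *)

(** * Real induction and one-sided differential inequalities *)

Lemma within_continuousP (R : realType) (U V : normedModType R) (A : set U)
    (v : U -> V) :
  {within A, continuous v} <->
  forall t, A t -> forall e : R, 0 < e ->
    \forall s \near t, A s -> `|v s - v t| < e.
Proof.
split=> [/subspace_continuousP vc t At e e0|vc].
  have /cvgrPdist_lt /(_ e e0) := vc _ At.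
  by rewrite near_withinE; apply: filterS => s /[apply]; rewrite distrC.
apply/subspace_continuousP => t At; apply/cvgrPdist_lt => e e0.
rewrite near_withinE; apply: filterS (vc t At e e0) => s /[apply].
by rewrite distrC.
Qed.

Lemma near_right0P (R : realType) (P : set R) :
  (\forall h \near 0^'+, P h) <->
  exists2 d : R, 0 < d & forall h, 0 < h < d -> P h.
Proof.
split=> [[d /= d0 dP]|[d d0 dP]].
  exists d => // h /andP[h0 hd]; apply: dP => //=.
  by rewrite sub0r normrN gtr0_norm.
exists d => // h /=; rewrite sub0r normrN => hd h0; apply: dP.
by rewrite h0 -[ltLHS]gtr0_norm.
Qed.

(** Real induction: the supremum of the set of times up to which [P] holds
    cannot stop before [b].  It serves both for monotonicity from Dini
    derivatives and for uniqueness of solutions. *)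
Lemma segment_induction (R : realType) (P : set R) (a b : R) : a <= b -> P a ->
  (forall t, a < t <= b -> (forall s, a <= s < t -> P s) -> P t) ->
  (forall t, a <= t < b -> (forall s, a <= s <= t -> P s) ->
     \forall h \near 0^'+, P (t + h)) ->
  P b.
Proof.
move=> ab Pa Pleft Pright.
pose A := [set t | a <= t <= b /\ forall s, a <= s <= t -> P s].
have Aa : A a.
  split; first by rewrite lexx ab.
  by move=> s; rewrite -eq_le => /eqP <-.
have Aub : ubound A b by move=> t [/andP[]].
have supA : has_sup A by split; [exists a | exists b].
have as_ : a <= sup A by apply: ub_le_sup Aa; exists b.
have sb : sup A <= b by apply: ge_sup => //; exists a.
have Plt s : a <= s < sup A -> P s.
  move=> /andP[as0 ss]; have [t [_ At] st] := sup_gt (ex_intro _ _ Aa) ss.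
  by apply: At; rewrite as0 ltW.
have Ps : P (sup A).
  move: as_; rewrite le_eqVlt => /predU1P[<- //|as1].
  by apply: Pleft => //; rewrite as1.
have Ple s : a <= s <= sup A -> P s.
  move=> /andP[as0]; rewrite le_eqVlt => /predU1P[-> //|ss].
  by apply: Plt; rewrite as0.
move: sb; rewrite le_eqVlt => /predU1P[<- //|sb].
have /near_right0P[d d0 dP] := Pright _ (introT andP (conj as_ sb)) Ple.
(* half of d, because P is only known at distances strictly below d *)
pose h := Num.min (d / 2) (b - sup A).
have h0 : 0 < h by rewrite lt_min divr_gt0 ?subr_gt0.
have hd : h < d by rewrite gt_min ltr_pdivrMr// ltr_pMr// ltr1n.
have hb : sup A + h <= b by rewrite -lerBrDl ge_min lexx orbT.
have : A (sup A + h).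
  split; first by rewrite hb (le_trans as_)// lerDl ltW.
  move=> s /andP[as0 ss]; have [sA|As] := leP s (sup A).
    by apply: Ple; rewrite as0.
  rewrite -(subrK (sup A) s) addrC; apply: dP.
  by rewrite subr_gt0 As ltrBlDl (le_lt_trans ss)// ltrD2l.
move=> /(ub_le_sup (ex_intro _ _ Aub)); rewrite gerDl leNgt h0 //.
Qed.

Lemma near_right_shift (R : realType) (a b t : R) (P : set R) : a <= t < b ->
  (\forall s \near t, s \in `[a, b] -> P s) ->
  \forall h \near 0^'+, P (t + h).
Proof.
move=> /andP[at_ tb] [d /= d0 dP]; apply/near_right0P.
exists (Num.min d (b - t)); first by rewrite lt_min d0 subr_gt0.
move=> h /andP[h0]; rewrite lt_min => /andP[hd hb]; apply: dP => /=.
  by rewrite opprD addNKr normrN gtr0_norm.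
by rewrite in_itv/= (le_trans at_)/= ?lerDl ?(ltW h0)// -lerBrDl ltW.
Qed.

Lemma near_left_point (R : realType) (a b t : R) (P : set R) : a < t <= b ->
  (\forall s \near t, s \in `[a, b] -> P s) -> exists2 s, a <= s < t & P s.
Proof.
move=> /andP[at_ tb] [d /= d0 dP].
pose h := Num.min (d / 2) (t - a).
have h0 : 0 < h by rewrite lt_min divr_gt0 ?subr_gt0.
have hd : h < d by rewrite gt_min ltr_pdivrMr// ltr_pMr// ltr1n.
have ha : a <= t - h by rewrite lerBrDl -lerBrDr ge_min lexx orbT.
exists (t - h); first by rewrite ha gtrBl.
apply: dP => /=; first by rewrite opprD opprK addNKr gtr0_norm.
by rewrite in_itv/= ha (le_trans _ tb)// gerBl ltW.
Qed.

(** Allowing a slope [e] and an initial margin [e], the inequality propagates by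
    real induction.  The margin gets the induction past [a], where only
    continuity is assumed, so that the differential inequality is needed at
    interior times alone: there [f] is differentiable and so is the primitive of
    [p]. *)
Lemma dini_le (R : realType) (v : R -> R) (a b : R) : a <= b ->
  {within `[a, b], continuous v} ->
  (forall t, a < t < b -> forall e, 0 < e ->
     \forall h \near 0^'+, v (t + h) <= v t + e * h) ->
  v b <= v a.
Proof.
move=> ab /within_continuousP vc dv.
suff : forall e, 0 < e -> v b <= v a + e + e * (b - a).
  move=> H; apply/ler_addgt0Pl => e e0.
  have k0 : 0 < 1 + (b - a) by rewrite ltr_wpDr ?subr_ge0.
  have := H (e / (1 + (b - a))) (divr_gt0 e0 k0).
  by rewrite -addrA -{1}[e / _]mulr1 -mulrDr divfK ?gt_eqF// addrC.
move=> e e0.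
have ge_slope s : a <= s -> v a + e <= v a + e + e * (s - a).
  by move=> as_; rewrite lerDl mulr_ge0 ?subr_ge0// ltW.
apply: (@segment_induction R [set t | v t <= v a + e + e * (t - a)] a b) => //=.
- by rewrite subrr mulr0 addr0 lerDl ltW.
- move=> t /andP[at_ tb] IH; apply/ler_addgt0Pr => k k0.
  have tI : `[a, b]%classic t by rewrite /= in_itv/= (ltW at_).
  have [s] := near_left_point (introT andP (conj at_ tb)) (vc t tI k k0).
  move=> ast; have := IH _ ast; move: ast => /andP[as_ st] IHs.
  rewrite ltr_norml => /andP[+ _]; rewrite ltrBrDr => vts.
  have st' : e * (s - a) <= e * (t - a) by rewrite ler_pM2l// lerD2r ltW.
  lra.
- move=> t /andP[at_ tb] IH; have IHt := IH t (introT andP (conj at_ (lexx t))).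
  have [ta|ta] := eqVneq t a.
    rewrite {}ta in at_ tb *.
    have aI : `[a, b]%classic a by rewrite /= in_itv/= lexx.
    have /near_right0P[d d0 dP] :=
      near_right_shift (introT andP (conj at_ tb)) (vc a aI e e0).
    apply/near_right0P; exists d => // h hd; have := dP _ hd.
    rewrite ltr_norml => /andP[_ vh]; have := ge_slope (a + h).
    rewrite lerDl => /(_ (ltW (andP hd).1)); lra.
  have at' : a < t by rewrite lt_neqAle eq_sym ta.
  have := dv t (introT andP (conj at' tb)) e e0.
  apply: filterS => h; lra.
Qed.

(** * Gronwall and mean value inequalities from right derivatives *)

Definition right_deriv (R : realType) (V : normedModType R) (x : R -> V)
    (t : R) (l : V) : Prop :=
  h^-1 *: (x (t + h) - x t) @[h --> 0^'+] --> l.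

Lemma right_derivP (R : realType) (V : normedModType R) (x : R -> V) t l :
  right_deriv x t l <->
  forall e, 0 < e -> \forall h \near 0^'+, `|x (t + h) - x t - h *: l| <= e * h.
Proof.
have eqh h : 0 < h ->
    `|x (t + h) - x t - h *: l| = h * `|l - h^-1 *: (x (t + h) - x t)|.
  move=> h0; rewrite -[X in X * _]gtr0_norm// -normrZ scalerBr scalerA.
  by rewrite divff ?gt_eqF// scale1r distrC.
split=> [/cvgrPdist_le H e e0|H].
  near=> h; have h0 : 0 < h by near: h; exact: nbhs_right_gt.
  rewrite eqh// mulrC ler_pM2r//; near: h; exact: H.
apply/cvgrPdist_le => /= e e0; near=> h.
have h0 : 0 < h by near: h; exact: nbhs_right_gt.
rewrite -(ler_pM2l h0) -eqh// mulrC; near: h; exact: H.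
Unshelve. all: by end_near. Qed.

Lemma right_deriv_cvg (R : realType) (V : normedModType R) (x : R -> V) t l :
  right_deriv x t l -> x (t + h) @[h --> 0^'+] --> x t.
Proof.
move=> xl.
have h0 : (h : R) @[h --> 0^'+] --> (0 : R).
  exact: cvg_at_right_filter.
have : x t + h *: (h^-1 *: (x (t + h) - x t)) @[h --> 0^'+] --> x t + 0 *: l.
  by apply: cvgD; [exact: cvg_cst|exact: cvgZ].
rewrite scale0r addr0; apply: cvg_trans; apply: near_eq_cvg; near=> h.
by rewrite scalerA divff ?scale1r ?subrKC.
Unshelve. all: by end_near. Qed.

(** [E] is an integrating factor, as [expR (- P)] for a primitive [P] of [p]:
    the Dini derivative of [u * E] is nonpositive by the product rule. *)
Lemma dini_gronwall (R : realType) (u E p : R -> R) (a b : R) : a <= b ->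
  {within `[a, b], continuous u} -> {within `[a, b], continuous E} ->
  (forall t, a < t < b -> 0 <= E t) ->
  (forall t, a < t < b -> right_deriv E t (- (p t * E t))) ->
  (forall t, a < t < b -> forall e, 0 < e ->
     \forall h \near 0^'+, u (t + h) <= u t + h * (p t * u t) + e * h) ->
  u b * E b <= u a * E a.
Proof.
move=> ab uc Ec E_ge0 Ed ud.
apply: (@dini_le R (fun t => u t * E t) a b) => //.
  by move=> t; apply: cvgM; [exact: uc|exact: Ec].
move=> t tab e e0; have E0 := E_ge0 t tab.
have k0 : 0 < e / (E t + 1) by rewrite divr_gt0// ltr_wpDl.
set k := e / (E t + 1) in k0.
have wlim : (p t * u t + k) * E (t + h) + u t * (h^-1 *: (E (t + h) - E t))
    @[h --> 0^'+] --> (p t * u t + k) * E t + u t * - (p t * E t).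
  apply: cvgD.
    by apply: cvgM; [exact: cvg_cst|exact: right_deriv_cvg (Ed t tab)].
  by apply: cvgM; [exact: cvg_cst|exact: Ed].
have we : (p t * u t + k) * E t + u t * - (p t * E t) < e.
  have -> : (p t * u t + k) * E t + u t * - (p t * E t) = k * E t by ring.
  by rewrite /k mulrAC ltr_pdivrMr ?ltr_wpDl// ltr_pM2l// ltrDl.
near=> h.
have h0 : 0 < h by near: h; exact: nbhs_right_gt.
have hb : h < b - t.
  by near: h; apply: nbhs_right_lt; rewrite subr_gt0 (andP tab).2.
have Eth0 : 0 <= E (t + h).
  by apply: E_ge0; rewrite (lt_trans (andP tab).1) ?ltrDl//= -ltrBrDl.
have uh : u (t + h) <= u t + h * (p t * u t) + k * h.
  by near: h; exact: ud.
have wh : (p t * u t + k) * E (t + h) + u t * (h^-1 *: (E (t + h) - E t)) <= e.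
  near: h; move/cvgr_le : wlim; exact.
apply: le_trans (ler_wpM2r Eth0 uh) _.
rewrite -(ler_pM2l h0) in wh; rewrite [e * h]mulrC -lerBlDl.
apply: le_trans wh; rewrite le_eqVlt; apply/orP; left; apply/eqP.
by rewrite /GRing.scale/=; field; rewrite gt_eqF.
Unshelve. all: by end_near. Qed.

(** Homogeneity is for positive factors because a directional derivative of a
    norm is in general not even. *)
Definition sublinear (R : realType) (V : normedModType R) (q : V -> R) (M : R) :
    Prop :=
  [/\ 0 < M, forall v w, q (v + w) <= q v + q w,
      forall h v, 0 < h -> q (h *: v) = h * q v & forall v, q v <= M * `|v|].

Lemma sublinear0 (R : realType) (V : normedModType R) (q : V -> R) M :
  sublinear q M -> q 0 = 0.
Proof.
case=> _ _ qZ _; have := qZ 2 0 (ltr0Sn _ 1).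
by rewrite scaler0; lra.
Qed.

Lemma sublinear_dist (R : realType) (V : normedModType R) (q : V -> R) M v w :
  sublinear q M -> `|q v - q w| <= M * `|v - w|.
Proof.
case=> M0 qD _ qM.
have H x y : q x - q y <= M * `|x - y|.
  rewrite lerBlDr; apply: le_trans (lerD (qM _) (lexx _)).
  by rewrite -{1}(subrK y x); exact: qD.
by rewrite ler_norml H lerNl opprB distrC H.
Qed.

Lemma sublinear_continuous (R : realType) (V : normedModType R) (q : V -> R) M :
  sublinear q M -> continuous q.
Proof.
move=> qs v; apply/cvgrPdist_le => /= e e0.
have M0 : 0 < M by case: qs.
near=> w.
apply: le_trans (sublinear_dist v w qs) _.
rewrite mulrC -ler_pdivlMr//; near: w.
by apply: (@cvgr_dist_le _ _ _ _ _ idfun) => //; rewrite divr_gt0.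
Unshelve. all: by end_near. Qed.

Lemma norm_sublinear (R : realType) (V : normedModType R) :
  sublinear (fun v : V => `|v|) 1.
Proof.
split=> //; first exact: ler_normD.
  by move=> h v h0; rewrite normrZ gtr0_norm.
by move=> v; rewrite mul1r.
Qed.

(** Subadditivity bounds the growth of [q (x t - x a)] by [q] of the increments
    of [x], so its Dini derivative at [t] is at most [q (x' t)].  This plays the
    part of Jensen's inequality for [q] and the integral of [x']. *)
Lemma sublinear_mean_value (R : realType) (V : normedModType R) (q : V -> R) M
    (x x' : R -> V) (a b k : R) : sublinear q M -> a <= b ->
  {within `[a, b], continuous x} ->
  (forall t, a < t < b -> right_deriv x t (x' t)) ->
  (forall t, a < t < b -> q (x' t) <= k) ->
  q (x b - x a) <= k * (b - a).
Proof.
move=> qs ab xc xd qk; have [M0 qD qZ qM] := qs.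
suff : q (x b - x a) - k * (b - a) <= q (x a - x a) - k * (a - a).
  by rewrite !subrr (sublinear0 qs) mulr0 subr0 subr_le0.
apply: (@dini_le R (fun t => q (x t - x a) - k * (t - a)) a b) => //.
  move=> t; apply: cvgB.
    apply: (@continuous_comp _ _ _ (fun s : subspace `[a, b] => x s - x a) q).
      by apply: cvgB; [exact: xc|exact: cvg_cst].
    exact: (sublinear_continuous qs).
  apply: cvgM; first exact: cvg_cst.
  apply: cvgB; last exact: cvg_cst.
  by apply: (@continuous_subspaceT _ _ _ (@idfun R)) => ?; exact: cvg_id.
move=> t tab e e0.
have /right_derivP/(_ (e / M) (divr_gt0 e0 M0)) := xd t tab.
have := nbhs_right_gt (0 : R); apply: filterS2 => h h0.
set r := x (t + h) - x t - h *: x' t => rle.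
have -> : x (t + h) - x a = (x t - x a) + (h *: x' t + r).
  by rewrite /r subrKC [RHS]addrC addrA subrK.
have qr : q r <= e * h.
  apply: le_trans (qM r) _; rewrite -ler_pdivlMl//.
  by apply: le_trans rle _; rewrite mulrA [M^-1 * _]mulrC.
have qh : q (h *: x' t) <= h * k by rewrite qZ// ler_pM2l// qk.
have := qD (x t - x a) (h *: x' t + r); have := qD (h *: x' t) r.
have -> : k * (t + h - a) = k * (t - a) + h * k by ring.
lra.
Qed.

(** * Norms of R^n and their directional derivatives *)

Lemma coord_le_norm (R : realType) m n (A : 'M[R]_(m, n)) i j :
  `|A i j| <= `|A|.
Proof.
rewrite [leRHS]/Num.Def.normr/= mx_normrE.
by apply: (le_bigmax _ (fun ij => `|A ij.1 ij.2|) (i, j)).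
Qed.

Lemma norm_le_coord (R : realType) m n (A : 'M[R]_(m, n)) c : 0 <= c ->
  (forall i j, `|A i j| <= c) -> `|A| <= c.
Proof.
by move=> c0 Ac; rewrite [leLHS]/Num.Def.normr/= mx_normrE; apply: bigmax_le.
Qed.

Lemma norm_trmx (R : realType) m n (A : 'M[R]_(m, n)) : `|A^T| = `|A|.
Proof.
apply/le_anti/andP; split; apply: norm_le_coord => // i j.
  by rewrite mxE; exact: coord_le_norm.
by apply: le_trans (coord_le_norm A^T j i); rewrite mxE.
Qed.

Lemma cV_sum_delta (R : realType) n (v : 'cV[R]_n) :
  v = \sum_i v i 0 *: delta_mx i 0.
Proof.
rewrite {1}[v]matrix_sum_delta; apply: eq_bigr => i _.
by rewrite big_ord1.
Qed.

Lemma is_norm0 (R : realType) n (N : 'cV[R]_n -> R) : is_norm N -> N 0 = 0.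
Proof. by case=> _ _ NZ _; rewrite -(scale0r 0) NZ normr0 mul0r. Qed.

Lemma is_normN (R : realType) n (N : 'cV[R]_n -> R) v :
  is_norm N -> N (- v) = N v.
Proof. by case=> _ _ NZ _; rewrite -scaleN1r NZ normrN1 mul1r. Qed.

Lemma is_norm_sum (R : realType) n (N : 'cV[R]_n -> R) (I : finType)
    (F : I -> 'cV[R]_n) : is_norm N -> N (\sum_i F i) <= \sum_i N (F i).
Proof.
move=> NN; have [_ _ _ ND] := NN.
elim/big_ind2 : _ => //; first by rewrite is_norm0.
by move=> u a w b ua wb; apply: le_trans (ND _ _) _; exact: lerD.
Qed.

Lemma is_norm_sublinear (R : realType) n (N : 'cV[R]_n -> R) :
  is_norm N -> exists K, sublinear N K.
Proof.
move=> NN; have [N0 _ NZ ND] := NN.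
exists (\sum_i N (delta_mx i 0) + 1); split => //.
- by rewrite ltr_wpDl// sumr_ge0.
- by move=> h v h0; rewrite NZ gtr0_norm.
move=> v; rewrite {1}[v]cV_sum_delta; apply: le_trans (is_norm_sum _ NN) _.
rewrite mulrDl mul1r -[leLHS]addr0 lerD// mulr_suml ler_sum// => i _.
by rewrite NZ mulrC ler_wpM2l// coord_le_norm.
Qed.

(** A continuous positive function on the compact unit sphere of the sup norm
    has a positive minimum.  The sphere is taken among row vectors, by
    transposition, to use [bounded_closed_compact]. *)
Lemma is_norm_dominates (R : realType) n (N : 'cV[R]_n -> R) :
  is_norm N -> exists2 c, 0 < c & forall v, `|v| <= c * N v.
Proof.
move=> NN; have [N0 N0eq NZ ND] := NN.
have [K Ns] := is_norm_sublinear NN.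
pose S := [set v : 'rV[R]_n | `|v| = 1].
have Scompact : compact S.
  apply: bounded_closed_compact.
    by exists 1; split; [exact: num_real|move=> M M1 v /= ->; exact: ltW].
  have -> : S = (fun v : 'rV[R]_n => `|v|) @^-1` [set 1] by [].
  by apply: closed_comp; [move=> v _; exact: norm_continuous|exact: closed_eq].
have Ncont : continuous (fun v : 'rV[R]_n => N v^T).
  have [K0 _ _ NK] := Ns; apply: (@sublinear_continuous _ _ _ K); split => //.
  - by move=> v w; rewrite linearD/= ND.
  - by move=> h v h0; rewrite linearZ/= NZ gtr0_norm.
  - by move=> v; rewrite -norm_trmx NK.
have [S0|/set0P[v0 Sv0]] := eqVneq S set0.
  exists 1 => // v; rewrite mul1r; have [->|v_neq0] := eqVneq v 0.
    by rewrite normr0.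
  have nv : `|v| != 0 by rewrite normr_eq0.
  have : S (`|v|^-1 *: v^T).
    by rewrite /S/= normrZ norm_trmx normfV normr_id mulVf.
  by rewrite S0.
have [v1 + v1min] := compact_EVT_min (ex_intro _ _ Sv0) Scompact
  (continuous_subspaceT Ncont).
rewrite inE /S/= => nv1.
have m0 : 0 < N v1^T.
  rewrite lt_neqAle N0 andbT eq_sym; apply/eqP => /N0eq v10.
  have := norm_trmx v1; rewrite v10 normr0 nv1.
  by move=> /eqP; rewrite eq_sym oner_eq0.
exists (N v1^T)^-1; first by rewrite invr_gt0.
move=> v; have [->|v_neq0] := eqVneq v 0.
  by rewrite normr0 is_norm0// mulr0.
have nv : 0 < `|v| by rewrite normr_gt0.
have /v1min : (`|v|^-1 *: v^T) \in S.
  by rewrite inE /S/= normrZ norm_trmx normfV normr_id mulVf// gt_eqF.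
rewrite linearZ/= trmxK NZ normfV normr_id => H.
by rewrite ler_pdivlMl// -ler_pdivlMr// mulrC.
Unshelve. all: by end_near. Qed.

Definition norm_slopes (R : realType) n (N : 'cV[R]_n -> R) (d w : 'cV[R]_n) :
    set R :=
  [set (N (d + h *: w) - N d) / h | h in [set h | 0 < h]].

(** The right derivative of [N] at [d] in the direction [w].  By convexity the
    slopes are nondecreasing in [h], so their infimum is their limit at 0. *)
Definition norm_dir (R : realType) n (N : 'cV[R]_n -> R) (d w : 'cV[R]_n) : R :=
  inf (norm_slopes N d w).

Lemma convex_slope_le (R : realType) n (N : 'cV[R]_n -> R) d w h k :
  is_norm N -> 0 < h -> h <= k ->
  (N (d + h *: w) - N d) / h <= (N (d + k *: w) - N d) / k.
Proof.
move=> [N0 _ NZ ND] h0 hk; have k0 := lt_le_trans h0 hk.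
have -> : d + h *: w = (1 - h / k) *: d + (h / k) *: (d + k *: w).
  rewrite scalerDr addrA -scalerDl subrK scale1r scalerA divfK//.
  by rewrite gt_eqF.
have hk1 : 0 <= 1 - h / k by rewrite subr_ge0 ler_pdivrMr// mul1r.
have hk0 : 0 <= h / k by rewrite divr_ge0// ltW.
rewrite ler_pdivrMr// mulrAC -mulrA.
have := ND ((1 - h / k) *: d) ((h / k) *: (d + k *: w)).
rewrite !NZ !ger0_norm// => H.
rewrite lerBlDr (le_trans H)// le_eqVlt; apply/orP; left; apply/eqP.
by ring.
Qed.

Lemma slope_bounded (R : realType) n (N : 'cV[R]_n -> R) d w h :
  is_norm N -> 0 < h -> `|(N (d + h *: w) - N d) / h| <= N w.
Proof.
move=> NN h0; have [N0 _ NZ ND] := NN.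
rewrite normf_div [`|h|]gtr0_norm// ler_pdivrMr//.
have hw : N (h *: w) = N w * h by rewrite NZ gtr0_norm// mulrC.
rewrite -hw ler_norml lerBlDl ND andbT lerBrDl lerBlDr.
by have := ND (d + h *: w) (- (h *: w)); rewrite addrK is_normN.
Qed.

Lemma norm_slopes_inf (R : realType) n (N : 'cV[R]_n -> R) d w :
  is_norm N -> has_inf (norm_slopes N d w).
Proof.
move=> NN; split; first by exists ((N (d + 1 *: w) - N d) / 1), 1 => /=.
exists (- N w) => _ [h /= h0 <-].
by have := slope_bounded d w NN h0; rewrite ler_norml => /andP[].
Qed.

Lemma norm_dir_le (R : realType) n (N : 'cV[R]_n -> R) d w h :
  is_norm N -> 0 < h -> norm_dir N d w <= (N (d + h *: w) - N d) / h.
Proof.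
by move=> NN h0; apply: ge_inf; [case: (norm_slopes_inf d w NN)|exists h].
Qed.

Lemma norm_dir_near (R : realType) n (N : 'cV[R]_n -> R) d w k :
  is_norm N -> norm_dir N d w < k ->
  \forall h \near 0^'+, (N (d + h *: w) - N d) / h < k.
Proof.
move=> NN /(inf_lt (norm_slopes_inf d w NN).1)[_ [h0 /= h00 <-] hk].
near=> h; apply: le_lt_trans hk; apply: convex_slope_le => //.
by near: h; exact: nbhs_right_le.
Unshelve. all: by end_near. Qed.

(** Subadditivity is the convexity of [N]: [d + (h / 2) *: (v + w)] is the
    midpoint of [d + h *: v] and [d + h *: w], and the slopes of all three are
    close to their infima for small [h]. *)
Lemma norm_dir_sublinear (R : realType) n (N : 'cV[R]_n -> R) d K :
  is_norm N -> sublinear N K -> sublinear (norm_dir N d) K.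
Proof.
move=> NN [K0 _ _ NK]; have [N0 _ NZ ND] := NN; split => //.
- move=> v w; apply/ler_addgt0Pr => e e0.
  have e2 : 0 < e / 2 by rewrite divr_gt0.
  have vd : norm_dir N d v < norm_dir N d v + e / 2 by rewrite ltrDl.
  have wd : norm_dir N d w < norm_dir N d w + e / 2 by rewrite ltrDl.
  near (0 : R)^'+ => h.
  have h0 : 0 < h by near: h; exact: nbhs_right_gt.
  have vh : (N (d + h *: v) - N d) / h < norm_dir N d v + e / 2.
    by near: h; exact: norm_dir_near.
  have wh : (N (d + h *: w) - N d) / h < norm_dir N d w + e / 2.
    by near: h; exact: norm_dir_near.
  have h2 : 0 < h / 2 by rewrite divr_gt0.
  apply: le_trans (norm_dir_le d (v + w) NN h2) _.
  have eq : d + (h / 2) *: (v + w) =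
      2^-1 *: (d + h *: v) + 2^-1 *: (d + h *: w).
    have half : 2^-1 + 2^-1 = 1 :> R by lra.
    rewrite !scalerDr addrACA -scalerDl half.
    by rewrite scale1r !scalerA [2^-1 * h]mulrC.
  have : N (d + (h / 2) *: (v + w)) <=
      2^-1 * N (d + h *: v) + 2^-1 * N (d + h *: w).
    by rewrite eq (le_trans (ND _ _))// !NZ gtr0_norm.
  move: vh wh; rewrite !ltr_pdivrMr// ler_pdivrMr//; lra.
- move=> h v h0; apply/le_anti/andP; split.
    rewrite mulrC -ler_pdivrMr//; apply: lb_le_inf.
      by case: (norm_slopes_inf d v NN).
    move=> _ [k /= k0 <-]; rewrite ler_pdivrMr//.
    have kh : 0 < k / h by exact: divr_gt0.
    apply: le_trans (norm_dir_le d (h *: v) NN kh) _.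
    rewrite scalerA divfK ?gt_eqF// invf_div mulrCA mulrC.
    by rewrite le_eqVlt eqxx.
  apply: lb_le_inf; first by case: (norm_slopes_inf d (h *: v) NN).
  move=> _ [k /= k0 <-]; rewrite mulrC -ler_pdivlMr//.
  have kh : 0 < k * h by exact: mulr_gt0.
  apply: le_trans (norm_dir_le d v NN kh) _.
  by rewrite scalerA invfM mulrA.
move=> v; apply: le_trans (norm_dir_le d v NN ltr01) _.
rewrite scale1r divr1; apply: le_trans (NK v).
by rewrite lerBlDl.
Unshelve. all: by end_near. Qed.

(** * The logarithmic norm *)

Lemma norm_mulmx_le (R : realType) n (G : 'M[R]_n) (x : 'cV[R]_n) :
  `|G *m x| <= n%:R * `|G| * `|x|.
Proof.
apply: norm_le_coord; first by rewrite !mulr_ge0.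
move=> i j; rewrite mxE; apply: le_trans (ler_norm_sum _ _ _) _.
rewrite -mulrA mulr_natl -[X in _ *+ X]card_ord -sumr_const ler_sum// => k _.
by rewrite normrM ler_pM// coord_le_norm.
Qed.

(** Without this, the supremum that defines [induced_norm] could take its
    default value. *)
Lemma induced_norm_has_sup (R : realType) n (N : 'cV[R]_n -> R) (G : 'M[R]_n) :
  is_norm N -> has_sup [set N (G *m x) | x in [set x | N x <= 1]].
Proof.
move=> NN; have [c c0 Nc] := is_norm_dominates NN.
have [K [K0 _ _ NK]] := is_norm_sublinear NN; split.
  by exists (N (G *m 0)), 0 => //=; rewrite is_norm0.
exists (K * (n%:R * `|G| * c)) => _ [x /= Nx <-].
apply: le_trans (NK _) _; rewrite ler_pM2l//.
apply: le_trans (norm_mulmx_le _ _) _; rewrite ler_wpM2l ?mulr_ge0//.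
by apply: le_trans (Nc x) _; rewrite -[leRHS]mulr1 ler_pM2l.
Qed.

Lemma induced_normP (R : realType) n (N : 'cV[R]_n -> R) (G : 'M[R]_n) x :
  is_norm N -> N (G *m x) <= induced_norm N G * N x.
Proof.
move=> NN; have [N0 N0eq NZ _] := NN.
have [->|x0] := eqVneq x 0; first by rewrite mulmx0 is_norm0// mulr0.
have Nx0 : 0 < N x.
  by rewrite lt_neqAle N0 andbT eq_sym; apply: contra x0 => /eqP/N0eq ->.
rewrite mulrC -ler_pdivrMl//.
have -> : (N x)^-1 * N (G *m x) = N (G *m ((N x)^-1 *: x)).
  by rewrite -scalemxAr NZ gtr0_norm// invr_gt0.
apply: ub_le_sup; first by case: (induced_norm_has_sup G NN).
exists ((N x)^-1 *: x) => //=.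
by rewrite NZ gtr0_norm ?invr_gt0// mulVf ?gt_eqF.
Qed.

Definition log_slope (R : realType) n (N : 'cV[R]_n -> R) (G : 'M[R]_n)
    (h : R) : R :=
  (induced_norm N (1%:M + h *: G) - 1) / h.

(** [1%:M + h *: G] is a convex combination of [1%:M] and [1%:M + k *: G]. *)
Lemma log_slope_le (R : realType) n (N : 'cV[R]_n -> R) (G : 'M[R]_n) h k :
  is_norm N -> 0 < h -> h <= k -> log_slope N G h <= log_slope N G k.
Proof.
move=> NN h0 hk; have [N0 _ NZ ND] := NN; have k0 := lt_le_trans h0 hk.
have hk1 : 0 <= 1 - h / k by rewrite subr_ge0 ler_pdivrMr// mul1r.
have hk0 : 0 <= h / k by rewrite divr_ge0// ltW.
suff H : induced_norm N (1%:M + h *: G) <=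
    (1 - h / k) + h / k * induced_norm N (1%:M + k *: G).
  rewrite /log_slope ler_pdivrMr// lerBlDr; apply: le_trans H _.
  by rewrite le_eqVlt; apply/orP; left; apply/eqP; field; rewrite gt_eqF.
apply: ge_sup; first by case: (induced_norm_has_sup (1%:M + h *: G) NN).
move=> _ [x /= Nx <-].
have -> : (1%:M + h *: G) *m x =
    (1 - h / k) *: x + (h / k) *: ((1%:M + k *: G) *m x).
  rewrite !mulmxDl !mul1mx scalerDr addrA -scalerDl subrK scale1r.
  by rewrite -!scalemxAl scalerA divfK// gt_eqF.
apply: le_trans (ND _ _) _; rewrite !NZ !ger0_norm//; apply: lerD.
  by rewrite -[leRHS]mulr1 ler_wpM2l.
rewrite ler_wpM2l//; apply: ub_le_sup; last by exists x.
by case: (induced_norm_has_sup (1%:M + k *: G) NN).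
Qed.

(** For every [h], [N (d + h *: (G *m d))] is at most the induced norm of
    [1%:M + h *: G] times [N d].  When [d] is nonzero, the limit in [log_norm]
    exists because the slopes are nondecreasing in [h] and bounded below by this
    very inequality; for [d = 0], which is the only case in dimension 0,
    both sides vanish whatever the value of that limit. *)
Lemma norm_dir_log_norm (R : realType) n (N : 'cV[R]_n -> R) (G : 'M[R]_n) d :
  is_norm N -> norm_dir N d (G *m d) <= log_norm N G * N d.
Proof.
move=> NN; have [N0 N0eq NZ _] := NN.
have [->|d0] := eqVneq d 0.
  have [K Ns] := is_norm_sublinear NN.
  by rewrite mulmx0 (sublinear0 (norm_dir_sublinear 0 NN Ns)) is_norm0// mulr0.
have Nd0 : 0 < N d.
  by rewrite lt_neqAle N0 andbT eq_sym; apply: contra d0 => /eqP/N0eq ->.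
have slope_ge h : 0 < h -> norm_dir N d (G *m d) / N d <= log_slope N G h.
  move=> h0; rewrite ler_pdivrMr//; apply: le_trans (norm_dir_le _ _ NN h0) _.
  rewrite /log_slope mulrAC ler_pM2r ?invr_gt0// mulrBl mul1r lerD2r.
  have -> : d + h *: (G *m d) = (1%:M + h *: G) *m d.
    by rewrite mulmxDl mul1mx scalemxAl.
  exact: induced_normP.
rewrite -ler_pdivrMr//; apply: limr_ge; last first.
  by near=> h; apply: slope_ge; near: h; exact: nbhs_right_gt.
apply: nondecreasing_at_right_is_cvgr; near=> x.
  move=> h k; rewrite !in_itv/= => /andP[h0 _] _ hk.
  exact: log_slope_le.
exists (norm_dir N d (G *m d) / N d) => _ [h /= + <-].
by rewrite in_itv/= => /andP[h0 _]; exact: slope_ge.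
Unshelve. all: by end_near. Qed.

(** * Vector fields of class C^1 *)

Lemma half_space_continuousP (R : realType) n (W : normedModType R)
    (g : R * 'cV[R]_n -> W) :
  {within [set q | 0 <= q.1], continuous g} ->
  forall (t : R) (z : 'cV[R]_n) (e : R), 0 <= t -> 0 < e ->
  exists2 d, 0 < d & forall t' z', 0 <= t' -> `|t' - t| < d -> `|z' - z| < d ->
    `|g (t', z') - g (t, z)| < e.
Proof.
move=> /within_continuousP gc t z e t0 e0.
have [[A B] /= [tA zB] AB] := gc (t, z) t0 e e0.
have /nbhs_normP[d1 /= d10 d1A] := tA; have /nbhs_normP[d2 /= d20 d2B] := zB.
exists (Num.min d1 d2); first by rewrite lt_min d10.
move=> t' z' t'0; rewrite !lt_min => /andP[td _] /andP[_ zd].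
apply: (AB (t', z')) => //; split => /=.
  by apply: d1A; rewrite /ball_/= distrC.
by apply: d2B; rewrite /ball_/= distrC.
Qed.

Lemma C1_half_space_near (R : realType) n
    (f : R -> 'cV[R]_n -> 'cV[R]_n) t z :
  C1_half_space f -> 0 <= t -> forall e, 0 < e ->
  exists2 d, 0 < d & forall t' z', 0 <= t' -> `|t' - t| < d -> `|z' - z| < d ->
    `|f t' z' - f t z| < e.
Proof. by move=> [fc _] t0 e e0; exact: (half_space_continuousP fc). Qed.

Lemma C1_line_continuous (R : realType) n
    (f : R -> 'cV[R]_n -> 'cV[R]_n) (t : R) (w v : 'cV[R]_n) :
  C1_half_space f -> 0 <= t -> continuous (fun r : R => f t (w + r *: v)).
Proof.
move=> fC1 t0 r; apply/cvgrPdist_lt => /= k k0.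
have [d d0 dP] := C1_half_space_near (w + r *: v) fC1 t0 k0.
have v1 : 0 < `|v| + 1 by rewrite ltr_wpDl.
near=> r'; rewrite distrC; apply: dP; rewrite ?subrr ?normr0//.
rewrite opprD addrACA subrr add0r -scalerBl normrZ.
apply: (@le_lt_trans _ _ (`|r' - r| * (`|v| + 1))).
  by rewrite ler_wpM2l// lerDl.
rewrite -ltr_pdivlMr// distrC; near: r'.
by apply: (@cvgr_dist_lt _ _ _ _ _ idfun) => //; rewrite divr_gt0.
Unshelve. all: by end_near. Qed.

Lemma C1_half_space_partial (R : realType) n (f : R -> 'cV[R]_n -> 'cV[R]_n) j :
  C1_half_space f -> exists2 g : R * 'cV[R]_n -> 'cV[R]_n,
    {within [set q | 0 <= q.1], continuous g} &
    forall t z, 0 < t ->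
      h^-1 *: (f t (z + h *: delta_mx j 0) - f t z) @[h --> 0^'] --> g (t, z)
      /\ col j (Jacobian (f t) z) = g (t, z).
Proof.
move=> [_ /(_ (Some j))[g [gc gP]]]; exists g => // t z t0.
have [/= dF DF] := gP (t, z) t0.
have fg : h^-1 *: (f t (z + h *: delta_mx j 0) - f t z) @[h --> 0^']
    --> g (t, z).
  rewrite -DF; apply: cvg_trans dF; apply: near_eq_cvg; near=> h => /=.
  by rewrite scaler0 add0r [_ + z]addrC.
have fg' : (fun h => h^-1 *: ((f t \o shift z) (h *: delta_mx j 0) - f t z))
    @ 0^' --> g (t, z).
  apply: cvg_trans fg; apply: near_eq_cvg; near=> h => /=.
  by rewrite [_ + z]addrC.
split=> //.
have fd : derivable (f t) z (delta_mx j 0) by apply/cvg_ex; exists (g (t, z)).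
have <- : 'D_(delta_mx j 0) (f t) z = g (t, z).
  by apply: (cvg_lim _ fg'); exact: norm_hausdorff.
rewrite derive_mx//.
by apply/colP => i; rewrite !mxE.
Unshelve. all: by end_near. Qed.

(** Mean value inequality along a coordinate direction, applied to [f t'] minus
    its linear part: the derivative of the difference is the variation of a
    continuous partial derivative, hence small. *)
Lemma C1_partial_increment (R : realType) n
    (f : R -> 'cV[R]_n -> 'cV[R]_n) t z j e :
  C1_half_space f -> 0 < t -> 0 < e ->
  exists2 d, 0 < d & forall t' w s, `|t' - t| < d -> `|w - z| < d ->
    `|w + s *: delta_mx j 0 - z| < d ->
    `|f t' (w + s *: delta_mx j 0) - f t' w - s *: col j (Jacobian (f t) z)|
      <= e * `|s|.
Proof.
move=> fC1 t0 e0; have [g gc gP] := C1_half_space_partial j fC1.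
have [d0 d00 dP] := half_space_continuousP gc z (ltW t0) e0.
exists (Num.min d0 t); first by rewrite lt_min d00.
rewrite (gP t z t0).2 => t' w s.
set D := delta_mx j 0; set d := Num.min d0 t => td wd wsd.
have t'0 : 0 < t'.
  move: td; rewrite lt_min => /andP[_]; rewrite distrC ltr_norml => /andP[_].
  by rewrite ltrBlDr ltrDl.
(* exchanging the endpoints w and w + s *: D changes the sign of s *)
wlog s0 : w s wd wsd / 0 <= s.
  move=> H; have [|s0] := leP 0 s; first exact: H.
  have := H (w + s *: D) (- s) wsd.
  rewrite !scaleNr addrK => /(_ wd); rewrite oppr_ge0 => /(_ (ltW s0)).
  rewrite [`|- s|]normrN opprK -[in X in _ -> X]normrN !opprB.
  by rewrite [X in _ -> `|X| <= _]addrC.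
rewrite (ger0_norm s0).
have fc : {within `[0, s],
    continuous (fun r => f t' (w + r *: D) - r *: g (t, z))}.
  apply: continuous_subspaceT => r; apply: cvgB; last first.
    by apply: cvgZr_tmp.
  exact: (C1_line_continuous fC1 (ltW t'0)).
have := @sublinear_mean_value _ _ _ _ _ (fun r => g (t', w + r *: D) - g (t, z))
  0 s e (norm_sublinear _) s0 fc.
rewrite scale0r addr0 scale0r subr0 subr0 addrAC; apply.
  move=> r /andP[r0 rs].
  have [/cvg_dnbhs_at_right H _] := gP t' (w + r *: D) t'0.
  have : h^-1 *: (f t' (w + r *: D + h *: D) - f t' (w + r *: D)) - g (t, z)
    @[h --> 0^'+] --> g (t', w + r *: D) - g (t, z).
    by apply: cvgB => //; exact: cvg_cst.
  apply: cvg_trans; apply: near_eq_cvg; near=> h.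
  have h0 : h != 0 by rewrite gt_eqF//; near: h; exact: nbhs_right_gt.
  rewrite [(r + h) *: D]scalerDl addrA.
  have -> A B : A - (r + h) *: g (t, z) - (B - r *: g (t, z)) =
      A - B - h *: g (t, z).
    by rewrite scalerDl opprB [r *: _ + _]addrC opprD !addrA subrK addrAC.
  by rewrite [h^-1 *: (_ - h *: _)]scalerBr scalerA mulVf// scale1r.
move=> r /andP[r0 rs]; have s1 : 0 < s by exact: lt_trans rs.
apply: ltW; apply: dP; first exact: ltW.
  by move: td; rewrite lt_min => /andP[].
have -> : w + r *: D - z = (1 - r / s) *: (w - z) + (r / s) *: (w + s *: D - z).
  rewrite [w + s *: D - z]addrAC [(r / s) *: _]scalerDr scalerA.
  rewrite divfK ?gt_eqF// addrA.
  by rewrite -scalerDl subrK scale1r addrAC.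
have l0 : 0 <= r / s by rewrite divr_ge0// ltW.
have l1 : 0 < 1 - r / s by rewrite subr_gt0 ltr_pdivrMr// mul1r.
have wd0 : `|w - z| < d0 by move: wd; rewrite lt_min => /andP[].
have wsd0 : `|w + s *: D - z| < d0 by move: wsd; rewrite lt_min => /andP[].
apply: le_lt_trans (ler_normD _ _) _; rewrite normrZ (gtr0_norm l1).
rewrite normrZ (ger0_norm l0).
have : (1 - r / s) * `|w - z| < (1 - r / s) * d0 by rewrite ltr_pM2l.
have : r / s * `|w + s *: D - z| <= r / s * d0 by rewrite ler_wpM2l// ltW.
lra.
Unshelve. all: by end_near. Qed.

Lemma Jacobian_col_sum (R : realType) n (J : 'M[R]_n) (v : 'cV[R]_n) :
  J *m v = \sum_j v j 0 *: col j J.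
Proof.
apply/colP => i; rewrite !mxE summxE; apply: eq_bigr => j _.
by rewrite !mxE mulrC.
Qed.

(** Change the coordinates of [z2] into those of [z1] one at a time; all
    intermediate points stay within the same sup-norm distance of [z]. *)
Lemma C1_strictly_differentiable (R : realType) n
    (f : R -> 'cV[R]_n -> 'cV[R]_n) t z e :
  C1_half_space f -> 0 < t -> 0 < e ->
  exists2 d, 0 < d & forall t' z1 z2, `|t' - t| < d -> `|z1 - z| < d ->
    `|z2 - z| < d ->
    `|f t' z1 - f t' z2 - Jacobian (f t) z *m (z1 - z2)| <= e * `|z1 - z2|.
Proof.
move=> fC1 t0 e0; pose e' := e / n.+1%:R.
have e'0 : 0 < e' by exact: divr_gt0.
have : \forall d \near 0^'+, forall j t' w s, `|t' - t| < d -> `|w - z| < d ->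
    `|w + s *: delta_mx j 0 - z| < d ->
    `|f t' (w + s *: delta_mx j 0) - f t' w - s *: col j (Jacobian (f t) z)|
      <= e' * `|s|.
  apply: filter_forall => j.
  have [d0 d00 dP] := C1_partial_increment z j fC1 t0 e'0.
  near=> d => t' w s td wd wsd.
  have dd : d <= d0 by near: d; exact: nbhs_right_le.
  by apply: dP; apply: lt_le_trans dd.
move=> /near_right0P[d0 d00 dP]; exists (d0 / 2); first by rewrite divr_gt0.
have {dP} := dP (d0 / 2).
rewrite divr_gt0//= ltr_pdivrMr// ltr_pMr// ltr1n => /(_ isT) dP.
move=> t' z1 z2 td z1d z2d.
pose w m : 'cV[R]_n := \col_i (if (i < m)%N then z1 i 0 else z2 i 0).
have w0 : w 0%N = z2 by apply/colP => i; rewrite mxE.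
have wn : w n = z1 by apply/colP => i; rewrite mxE ltn_ord.
have wS (j : 'I_n) : w j.+1 = w j + (z1 - z2) j 0 *: delta_mx j 0.
  apply/colP => i; rewrite !mxE ltnS leq_eqVlt eqxx andbT.
  have [->|ij] := eqVneq i j; first by rewrite eqxx/= ltnn mulr1 subrKC.
  by rewrite -[(i == j :> nat)]/(i == j) (negbTE ij)/= mulr0 addr0.
have wd m : `|w m - z| < d0 / 2.
  apply: (@le_lt_trans _ _ (Num.max `|z1 - z| `|z2 - z|)); last first.
    by rewrite gt_max z1d.
  apply: norm_le_coord; first by rewrite le_max normr_ge0.
  move=> i k; rewrite ord1 !mxE le_max; case: ifP => _; apply/orP.
    by left; have := coord_le_norm (z1 - z) i 0; rewrite !mxE.
  by right; have := coord_le_norm (z2 - z) i 0; rewrite !mxE.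
have -> : f t' z1 - f t' z2 = \sum_(j < n) (f t' (w j.+1) - f t' (w j)).
  rewrite -{1}wn -{1}w0 -(telescope_sumr (fun m => f t' (w m)) (leq0n n)).
  by rewrite big_mkord.
rewrite Jacobian_col_sum -sumrB; apply: le_trans (ler_norm_sum _ _ _) _.
apply: (@le_trans _ _ (\sum_(j < n) e' * `|z1 - z2|)).
  apply: ler_sum => j _; rewrite wS.
  apply: le_trans (dP j t' (w j) ((z1 - z2) j 0) td (wd j) _) _.
    by rewrite -wS.
  by rewrite ler_pM2l// coord_le_norm.
rewrite sumr_const card_ord -mulr_natl mulrA ler_wpM2r// /e'.
rewrite mulrCA ger_pMr// ler_pdivrMr ?ltr0n// mul1r ler_nat//.
Unshelve. all: by end_near. Qed.

(** * Solutions of differential equations *)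

Lemma ode_solutionP (R : realType) n (f : R -> 'cV[R]_n -> 'cV[R]_n)
    (I : set R) (x : R -> 'cV[R]_n) :
  ode_solution f I x <->
  forall t, I t -> forall e : R, 0 < e -> exists2 d : R, 0 < d &
    forall s, I s -> `|s - t| < d ->
      `|x s - x t - (s - t) *: f t (x t)| <= e * `|s - t|.
Proof.
have eqs s t : s != t -> `|x s - x t - (s - t) *: f t (x t)| =
    `|s - t| * `|f t (x t) - (s - t)^-1 *: (x s - x t)|.
  move=> st; rewrite -normrZ scalerBr scalerA divff ?subr_eq0//.
  by rewrite scale1r distrC.
split=> [xs t It e e0|xs t It].
  have /cvgrPdist_le/(_ e e0) := xs t It.
  rewrite near_withinE => /nbhs_normP[d /= d0 dP].
  exists d => // s Is sd; have [->|st] := eqVneq s t.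
    by rewrite !subrr scale0r subrr !normr0 mulr0.
  rewrite eqs// mulrC ler_wpM2r//; apply: dP => //.
  by rewrite /ball_/= distrC.
apply/cvgrPdist_le => /= e e0; have [d d0 dP] := xs t It e e0.
rewrite near_withinE; exists d => // s /= sd st Is.
rewrite -(@ler_pM2l _ `|s - t|) ?normr_gt0 ?subr_eq0// -eqs// mulrC.
by apply: dP => //; rewrite distrC.
Qed.

Lemma ode_solution_sub (R : realType) n (f : R -> 'cV[R]_n -> 'cV[R]_n)
    (I J : set R) (x : R -> 'cV[R]_n) :
  J `<=` I -> ode_solution f I x -> ode_solution f J x.
Proof.
move=> JI /ode_solutionP xs; apply/ode_solutionP => t Jt e e0.
have [d d0 dP] := xs t (JI _ Jt) e e0; exists d => // s Js; exact: dP (JI _ Js).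
Qed.

Lemma ode_solution_shift (R : realType) n (f : R -> 'cV[R]_n -> 'cV[R]_n)
    (I J : set R) (x : R -> 'cV[R]_n) c :
  (forall t, J t -> I (t + c)) -> (forall t y, J t -> f (t + c) y = f t y) ->
  ode_solution f I x -> ode_solution f J (fun t => x (t + c)).
Proof.
move=> JI fc /ode_solutionP xs; apply/ode_solutionP => t Jt e e0.
have [d d0 dP] := xs _ (JI _ Jt) e e0; exists d => // s Js sd.
have -> : s - t = (s + c) - (t + c) by ring.
rewrite -fc//; apply: dP; first exact: JI.
by have -> : (s + c) - (t + c) = s - t by ring.
Qed.

Lemma ode_solution_continuous (R : realType) n (f : R -> 'cV[R]_n -> 'cV[R]_n)
    (I : set R) (x : R -> 'cV[R]_n) :
  ode_solution f I x -> {within I, continuous x}.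
Proof.
move=> /ode_solutionP xs; apply/within_continuousP => t It e e0.
have [d d0 dP] := xs t It 1 ltr01.
have k0 : 0 < 1 + `|f t (x t)| + 1 by rewrite ltr_wpDl// addr_ge0.
(* near t, x has slopes at most 1 + |f t (x t)|; one more gives strictness *)
exists (Num.min d (e / (1 + `|f t (x t)| + 1))).
  by rewrite /= lt_min d0 divr_gt0.
move=> s /= + Is; rewrite distrC lt_min => /andP[sd se].
rewrite -(subrK ((s - t) *: f t (x t)) (x s - x t)).
apply: le_lt_trans (ler_normD _ _) _.
rewrite ltr_pdivlMr// in se; apply: le_lt_trans se.
rewrite normrZ.
have := dP s Is sd; have : 0 <= `|s - t| by []; lra.
Qed.

Lemma ode_solution_right_deriv (R : realType) n
    (f : R -> 'cV[R]_n -> 'cV[R]_n) a b (x : R -> 'cV[R]_n) t :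
  ode_solution f `[a, b] x -> a <= t < b -> right_deriv x t (f t (x t)).
Proof.
move=> /ode_solutionP xs atb; apply/right_derivP => e e0.
have tI : `[a, b]%classic t.
  by move/andP: atb => [at_ tb]; rewrite /= in_itv/= at_ ltW.
have [d d0 dP] := xs t tI e e0.
have ball_d : \forall s \near t, s \in `[a, b] ->
    `|x s - x t - (s - t) *: f t (x t)| <= e * `|s - t|.
  by exists d => // s /= ts sI; apply: (dP s sI); rewrite distrC.
near=> h; have h0 : 0 < h by near: h; exact: nbhs_right_gt.
have : `|x (t + h) - x t - (t + h - t) *: f t (x t)| <= e * `|t + h - t|.
  by near: h; exact: near_right_shift ball_d.
by rewrite [t + h]addrC addrK gtr0_norm.
Unshelve. all: by end_near. Qed.

Lemma is_derive_right_deriv (R : realType) (g : R -> R) (t l : R) :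
  is_derive t 1 g l -> right_deriv g t l.
Proof.
move=> [gd <-]; apply: cvg_dnbhs_at_right; apply: cvg_trans gd.
apply: near_eq_cvg; near=> h => /=.
by rewrite /GRing.scale/= mulr1 [h + t]addrC.
Unshelve. all: by end_near. Qed.

Lemma expR_opp_right_deriv (R : realType) (P : R -> R) (t p : R) :
  is_derive t 1 P p ->
  right_deriv (fun s => expR (- P s)) t (- (p * expR (- P t))).
Proof.
move=> Pd; apply: is_derive_right_deriv.
have dN : is_derive t 1 (- P) (- p) by exact: is_deriveN.
have -> : - (p * expR (- P t)) = expR (- P t) * - p by ring.
exact: (@is_derive1_comp _ expR (- P) t (expR (- P t)) (- p)).
Qed.

Lemma right_derivB (R : realType) (V : normedModType R) (x y : R -> V) t l m :
  right_deriv x t l -> right_deriv y t m ->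
  right_deriv (fun s => x s - y s) t (l - m).
Proof.
move=> xl ym; rewrite /right_deriv.
have -> : (fun h => h^-1 *: (x (t + h) - y (t + h) - (x t - y t))) =
    (fun h => h^-1 *: (x (t + h) - x t) - h^-1 *: (y (t + h) - y t)).
  by apply/funext => h; rewrite -scalerBr opprD addrACA -opprD.
exact: cvgB.
Qed.

(** [x (t + h) - y (t + h)] is [d + h *: w] up to [o(h)], where [d] is the
    difference of the solutions at [t] and [w] that of the velocities, so the
    Dini derivative of [N (x t - y t)] is at most [norm_dir N d w]. *)
Lemma difference_gronwall (R : realType) n (f : R -> 'cV[R]_n -> 'cV[R]_n)
    (N : 'cV[R]_n -> R) (x y : R -> 'cV[R]_n) (P p : R -> R) (a b : R) :
  is_norm N -> a <= b ->
  {within `[a, b], continuous P} ->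
  (forall t, a < t < b -> is_derive t 1 P (p t)) ->
  ode_solution f `[a, b] x -> ode_solution f `[a, b] y ->
  (forall t, a < t < b ->
     norm_dir N (x t - y t) (f t (x t) - f t (y t)) <= p t * N (x t - y t)) ->
  N (x b - y b) * expR (- P b) <= N (x a - y a) * expR (- P a).
Proof.
move=> NN ab Pc Pd xs ys H; have [N0 _ NZ ND] := NN.
have [K Ns] := is_norm_sublinear NN; have [K0 _ _ NK] := Ns.
apply: (@dini_gronwall R (fun t => N (x t - y t))
  (fun t => expR (- P t)) p) => //.
- move=> t.
  apply: (@continuous_comp _ _ _ (fun s : subspace `[a, b] => x s - y s) N).
    by apply: cvgB; [exact: (ode_solution_continuous xs)|
                     exact: (ode_solution_continuous ys)].
  exact: (sublinear_continuous Ns).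
- move=> t.
  apply: (@continuous_comp _ _ _ (fun s : subspace `[a, b] => - P s) expR).
    by apply: cvgN; exact: Pc.
  exact: continuous_expR.
- by move=> t tab; apply: expR_opp_right_deriv; exact: Pd.
move=> t /[dup] tab /andP[at_ tb] e e0; have atb : a <= t < b by rewrite ltW.
have dd := right_derivB (ode_solution_right_deriv xs atb)
                        (ode_solution_right_deriv ys atb).
have e2 : 0 < e / 2 by exact: divr_gt0.
have /right_derivP/(_ (e / 2 / K) (divr_gt0 e2 K0)) := dd.
set d := x t - y t; set w := f t (x t) - f t (y t).
have Hk : norm_dir N d w < p t * N d + e / 2.
  by apply: le_lt_trans (H t tab) _; rewrite ltrDl.
have := norm_dir_near NN Hk.
apply: filterS3 (nbhs_right_gt (0 : R)) => h h0.
rewrite ltr_pdivrMr// => hd.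
set r := _ - d - _ => rle.
have -> : x (t + h) - y (t + h) = (d + h *: w) + r.
  by rewrite /r [RHS]addrC [d + _]addrC addrA !subrK.
have rN : N r <= e / 2 * h.
  apply: le_trans (NK r) _; rewrite -ler_pdivlMl//.
  by apply: le_trans rle _; rewrite mulrA [K^-1 * _]mulrC.
have := ND (d + h *: w) r; lra.
Qed.

Lemma normr_is_norm (R : realType) n : is_norm (fun x : 'cV[R]_n => `|x|).
Proof.
split=> //; first exact: normr0_eq0.
  by move=> a x; rewrite normrZ.
exact: ler_normD.
Qed.

(** The partial derivatives of [f] are only given at positive times; periodicity
    moves a neighbourhood of [t = 0] to a neighbourhood of [T]. *)
Lemma locally_lipschitz (R : realType) n (f : R -> 'cV[R]_n -> 'cV[R]_n)
    (T t : R) z :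
  C1_half_space f -> 0 < T -> (forall t x, 0 <= t -> f (t + T) x = f t x) ->
  0 <= t ->
  exists L, exists2 d, 0 < d & forall t' z1 z2, 0 <= t' -> `|t' - t| < d ->
    `|z1 - z| < d -> `|z2 - z| < d -> `|f t' z1 - f t' z2| <= L * `|z1 - z2|.
Proof.
move=> fC1 T0 fT t0; have tT : 0 < t + T by rewrite ltr_wpDl.
have [d d0 dP] := C1_strictly_differentiable z fC1 tT ltr01.
set J := Jacobian _ _ in dP.
exists (1 + n%:R * `|J|); exists d => // t' z1 z2 t'0 td z1d z2d.
have td' : `|t' + T - (t + T)| < d.
  by rewrite (_ : t' + T - (t + T) = t' - t)//; ring.
have := dP (t' + T) z1 z2 td' z1d z2d; rewrite !fT// => H.
rewrite -(subrK (J *m (z1 - z2)) (f t' z1 - f t' z2)).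
apply: le_trans (ler_normD _ _) _; rewrite mulrDl; apply: lerD => //.
exact: norm_mulmx_le.
Qed.

(** Real induction on the times up to which [x] and [y] agree: past such a time
    [t], both remain for a while near [x t], where a Lipschitz bound and
    Gronwall keep their distance equal to zero. *)
Lemma ode_solution_unique (R : realType) n (f : R -> 'cV[R]_n -> 'cV[R]_n)
    (T a b : R) (x y : R -> 'cV[R]_n) :
  C1_half_space f -> 0 < T -> (forall t x, 0 <= t -> f (t + T) x = f t x) ->
  0 <= a -> a <= b ->
  ode_solution f `[a, b] x -> ode_solution f `[a, b] y ->
  x a = y a -> x b = y b.
Proof.
move=> fC1 T0 fT a0 ab xs ys xya.
have /within_continuousP xc := ode_solution_continuous xs.
have /within_continuousP yc := ode_solution_continuous ys.
apply: (@segment_induction R [set t | x t = y t] a b) => //=.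
- move=> t /[dup] atb /andP[at_ tb] IH.
  have tI : `[a, b]%classic t by rewrite /= in_itv/= ltW.
  apply/eqP; rewrite -subr_eq0 -normr_le0; apply/ler_addgt0Pr => e e0.
  have e2 : 0 < e / 2 by exact: divr_gt0.
  have near_t : \forall s \near t, s \in `[a, b] ->
      `|x s - x t| < e / 2 /\ `|y s - y t| < e / 2.
    by apply: filterS2 (xc t tI _ e2) (yc t tI _ e2) => s xst yst sI; split;
      [exact: xst|exact: yst].
  have [s ast [xst yst]] := near_left_point atb near_t.
  rewrite add0r -(subrKA (x s)) {2}(IH s ast).
  apply: le_trans (ler_normD _ _) _; rewrite [`|x t - _|]distrC; lra.
move=> t /[dup] atb /andP[at_ tb] IH.
have tI : `[a, b]%classic t by rewrite /= in_itv/= at_ ltW.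
have xyt : x t = y t by apply: IH; rewrite at_ /=.
have [L [d d0 dP]] := locally_lipschitz (x t) fC1 T0 fT (le_trans a0 at_).
have /near_right0P[d1 d10 d1P] := near_right_shift atb (xc t tI d d0).
have /near_right0P[d2 d20 d2P] := near_right_shift atb (yc t tI d d0).
near=> h; have h0 : 0 < h by near: h; exact: nbhs_right_gt.
have hb : h < b - t by near: h; apply: nbhs_right_lt; rewrite subr_gt0.
have hd : h < d by near: h; exact: nbhs_right_lt.
have hd1 : h < d1 by near: h; exact: nbhs_right_lt.
have hd2 : h < d2 by near: h; exact: nbhs_right_lt.
have sub : `[t, t + h] `<=` `[a, b].
  move=> s /=; rewrite !in_itv/= => /andP[ts sh]; rewrite (le_trans at_ ts)/=.
  by rewrite (le_trans sh)// -lerBrDl ltW.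
have th : t <= t + h by rewrite lerDl ltW.
have P' (s : R) : is_derive s 1 (fun r : R => L * r) L.
  have -> : (fun r : R => L * r) = L \*: (idfun : R -> R) by [].
  by rewrite -[X in is_derive _ _ _ X]mulr1; exact: is_deriveZ.
have Pc : {within `[t, t + h], continuous (fun r : R => L * r)}.
  by apply: continuous_subspaceT => r; exact: mulrl_continuous.
have := difference_gronwall (p := cst L) (normr_is_norm R n) th Pc
  (fun s _ => P' s) (ode_solution_sub sub xs) (ode_solution_sub sub ys) _.
rewrite xyt subrr normr0 mul0r => H.
apply/eqP; rewrite -subr_eq0 -normr_le0.
rewrite -(pmulr_lle0 _ (expR_gt0 (- (L * (t + h))))).
apply: H => s /andP[ts sh] /=.
have [_ _ _ nd] := norm_dir_sublinear (x s - y s) (normr_is_norm R n)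
  (norm_sublinear _).
apply: le_trans (nd _) _; rewrite mul1r.
have s0 : 0 < s - t by rewrite subr_gt0.
have sth : s - t < h by rewrite ltrBlDl.
have ts1 : t + (s - t) = s by rewrite addrC subrK.
have std1 : 0 < s - t < d1 by rewrite s0 (lt_trans sth).
have std2 : 0 < s - t < d2 by rewrite s0 (lt_trans sth).
apply: dP.
- by rewrite (le_trans a0)// (le_trans at_)// ltW.
- by rewrite gtr0_norm// (lt_trans sth).
- by have := d1P _ std1; rewrite ts1.
- by have := d2P _ std2; rewrite ts1 xyt.
Unshelve. all: by end_near. Qed.

Lemma flow_eq (R : realType) n (f : R -> 'cV[R]_n -> 'cV[R]_n)
    (T t0 t : R) x0 (x : R -> 'cV[R]_n) :
  C1_half_space f -> 0 < T -> (forall t x, 0 <= t -> f (t + T) x = f t x) ->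
  0 <= t0 -> t0 <= t -> ode_solution f `[t0, t] x -> x t0 = x0 ->
  flow f t t0 x0 = x t.
Proof.
move=> fC1 T0 fT t00 t0t xs xx0.
have : reached f t t0 x0 (flow f t t0 x0) by apply: xgetPex; exists (x t), x.
move=> [y [_ ys yx0 <-]].
by apply: (ode_solution_unique fC1 T0 fT t00 t0t ys xs); rewrite yx0.
Qed.

(** Near a given time, the values of the flow are those of one solution, defined
    up to a later time [t1]: the choices made for different times agree by
    uniqueness. *)
Lemma flow_solution (R : realType) n (f : R -> 'cV[R]_n -> 'cV[R]_n)
    (T t0 tau : R) x0 :
  C1_half_space f -> 0 < T -> (forall t x, 0 <= t -> f (t + T) x = f t x) ->
  0 <= t0 -> (forall t, tau <= t -> flow_defined f t t0 x0) ->
  ode_solution f `[t0, +oo[ (fun t => flow f t t0 x0).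
Proof.
move=> fC1 T0 fT t00 fd; apply/ode_solutionP => t /=.
rewrite in_itv/= andbT => t0t e e0.
pose t1 := Num.max tau (t + 1).
have tt1 : t + 1 <= t1 by rewrite le_max lexx orbT.
have [_ [x [_ xs xx0 _]]] : flow_defined f t1 t0 x0.
  by apply: fd; rewrite le_max lexx.
have flow_x s : t0 <= s -> s <= t1 -> flow f s t0 x0 = x s.
  move=> t0s st1; apply: (flow_eq fC1 T0 fT t00 t0s _ xx0).
  apply: ode_solution_sub xs => r /=; rewrite !in_itv/= => /andP[->/= rs].
  exact: le_trans rs st1.
have t_le : t <= t1 by rewrite (le_trans _ tt1)// lerDl.
move/ode_solutionP : xs => /(_ t _ e e0)[|d d0 dP].
  by rewrite /= in_itv/= t0t.
exists (Num.min d 1); first by rewrite lt_min d0/=.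
move=> s; rewrite /= in_itv/= andbT lt_min => t0s /andP[sd s1].
have st1 : s <= t1.
  apply: le_trans tt1; rewrite -lerBlDl; apply: le_trans (ltW s1).
  exact: ler_norm.
rewrite !flow_x//; apply: dP => //.
by rewrite /= in_itv/= t0s.
Qed.

(** * Contraction between solutions that stay in a convex set *)

Lemma integral_derivative (R : realType) (p : R -> R) (T : R) : 0 < T ->
  {within `[0, +oo[, continuous p} ->
  exists P : R -> R, [/\ {within `[0, T], continuous P},
    forall t, 0 < t < T -> is_derive t 1 P (p t), P 0 = 0
    & P T = \int[lebesgue_measure]_(s in `[0, T]) p s].
Proof.
move=> T0 pc.
have sub : `[0, T] `<=` `[(0 : R), +oo[.
  by move=> t /=; rewrite !in_itv/= andbT => /andP[].
have pcT : {within `[0, T], continuous p} := continuous_subspaceW sub pc.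
have pint : lebesgue_measure.-integrable `[0, T] (EFin \o p).
  by apply: continuous_compact_integrable => //; exact: segment_compact.
exists (fun t => \int[lebesgue_measure]_(s in `[0, t]) p s); split.
- exact: (parameterized_integral_continuous (ltW T0) pint).
- move=> t /andP[t0 tT].
  have pt : {for t, continuous p}.
    have tI : t \in `]0, T[ by rewrite in_itv/= t0.
    have pco : {within `]0, T[, continuous p}.
      by apply: continuous_subspaceW pcT; exact: subset_itv_oo_cc.
    have opn : open (`]0, T[%classic : set R) by exact: itv_open.
    move: pco; rewrite continuous_open_subspace// => /(_ t); apply.
    by rewrite inE.
  have [dP PE] := continuous_FTC1_closed tT pint t0 pt.
  by apply: DeriveDef => //; rewrite -derive1E.
- by rewrite set_itv1 Rintegral_set1.
- by [].
Qed.

Lemma C1_right_deriv_line (R : realType) n (f : R -> 'cV[R]_n -> 'cV[R]_n)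
    (t : R) (w v : 'cV[R]_n) (r : R) :
  C1_half_space f -> 0 < t ->
  right_deriv (fun s => f t (w + s *: v)) r (Jacobian (f t) (w + r *: v) *m v).
Proof.
move=> fC1 t0; apply/right_derivP => e e0.
have v1 : 0 < `|v| + 1 by rewrite ltr_wpDl.
have [d d0 dP] :=
  C1_strictly_differentiable (w + r *: v) fC1 t0 (divr_gt0 e0 v1).
near=> h; have h0 : 0 < h by near: h; exact: nbhs_right_gt.
have hv : `|h *: v| < d.
  rewrite normrZ gtr0_norm//; apply: (@le_lt_trans _ _ (h * (`|v| + 1))).
    by rewrite ler_wpM2l ?lerDl// ltW.
  by rewrite -ltr_pdivlMr//; near: h; apply: nbhs_right_lt; exact: divr_gt0.
have hE : w + (r + h) *: v - (w + r *: v) = h *: v.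
  by rewrite scalerDl addrA [_ + h *: v]addrC addrK.
have := dP t (w + (r + h) *: v) (w + r *: v).
rewrite hE !subrr !normr0 -scalemxAr => /(_ d0 hv d0) H.
apply: le_trans H _; rewrite normrZ gtr0_norm// mulrAC ler_pdivrMr//.
by rewrite -mulrA ler_pM2l// ler_pM2l// lerDl.
Unshelve. all: by end_near. Qed.

(** Along the segment from [y] to [x], which lies in [C], the derivative of
    [f t] is the Jacobian applied to [x - y]; [norm_dir N (x - y)] of it is at most
    [k * N (x - y)], and the mean value inequality integrates this bound.  The
    base point [x - y] of [norm_dir] does not move along the segment. *)
Lemma one_sided_lipschitz (R : realType) n (f : R -> 'cV[R]_n -> 'cV[R]_n)
    (N : 'cV[R]_n -> R) (C : set 'cV[R]_n) (t k : R) x y :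
  C1_half_space f -> is_norm N -> convex_set C -> 0 < t ->
  (forall z, C z -> log_norm N (Jacobian (f t) z) <= k) -> C x -> C y ->
  norm_dir N (x - y) (f t x - f t y) <= k * N (x - y).
Proof.
move=> fC1 NN Cconv t0 Ck Cx Cy; have [K Ns] := is_norm_sublinear NN.
have N0 : 0 <= N (x - y) by case: NN.
have Cseg r : 0 <= r -> r <= 1 -> C (y + r *: (x - y)).
  move=> r0 r1; have := Cconv x y (Itv01 r0 r1).
  rewrite !inE => /(_ Cx Cy); congr (C _).
  rewrite /conv/= /unstable.onem scalerBl scale1r scalerBr addrCA.
  by rewrite addrA.
have fc : {within `[0, 1], continuous (fun r : R => f t (y + r *: (x - y)))}.
  by apply: continuous_subspaceT; exact: (C1_line_continuous fC1 (ltW t0)).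
have := sublinear_mean_value (norm_dir_sublinear (x - y) NN Ns) ler01 fc
  (fun r _ => @C1_right_deriv_line R n f t y (x - y) r fC1 t0).
rewrite scale1r subrKC scale0r addr0 subr0 => H.
rewrite -[leRHS]mulr1; apply: H.
move=> r /andP[r0 r1]; apply: le_trans (norm_dir_log_norm _ _ NN) _.
by rewrite ler_wpM2r//; apply: Ck; apply: Cseg; exact: ltW.
Qed.

Definition solution_in (R : realType) n (f : R -> 'cV[R]_n -> 'cV[R]_n)
    (C : set 'cV[R]_n) (z : R -> 'cV[R]_n) : Prop :=
  ode_solution f `[0, +oo[ z /\ forall t, 0 <= t -> C (z t).

Lemma periodic_mul (R : realType) (V : Type) (T : R) (x : R -> V) k t :
  0 < T -> periodic_on_nneg T x -> 0 <= t -> x (t + k%:R * T) = x t.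
Proof.
move=> T0 xT t0; elim: k => [|k IH]; first by rewrite mul0r addr0.
rewrite -natr1 mulrDl mul1r addrA xT//.
by rewrite addr_ge0// mulr_ge0// ltW.
Qed.

Lemma solution_in_shift (R : realType) n (f : R -> 'cV[R]_n -> 'cV[R]_n)
    (T : R) C z k : 0 < T -> (forall t x, 0 <= t -> f (t + T) x = f t x) ->
  solution_in f C z -> solution_in f C (fun t => z (t + k%:R * T)).
Proof.
move=> T0 fT [zs zC]; have kT : 0 <= k%:R * T by rewrite mulr_ge0// ltW.
split=> [|t t0]; last by apply: zC; exact: addr_ge0.
apply: ode_solution_shift zs => t /=; rewrite !in_itv/= !andbT.
  by move=> t0; exact: addr_ge0.
move=> y t0; apply: (@periodic_mul _ _ T (f^~ y) k t T0 _ t0) => s s0.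
exact: fT.
Qed.

Lemma period_decomposition (R : realType) (T t : R) : 0 < T -> 0 <= t ->
  exists k s, [/\ 0 <= s, s <= T & t = s + k%:R * T].
Proof.
move=> T0 t0; have tT : 0 <= t / T by rewrite divr_ge0// ltW.
have /andP[kt tk] := truncn_itv tT.
exists (Num.truncn (t / T)), (t - (Num.truncn (t / T))%:R * T).
rewrite subrK subr_ge0 -ler_pdivlMr//; split => //.
by rewrite lerBlDr -[X in X + _]mul1r -mulrDl nat1r -ler_pdivrMr// ltW.
Qed.

(** For a primitive [P] of [p] with [P 0 = 0], the witnesses are
    [c = expR (P T)] and [M], the maximum of [expR (P t)] on the period. *)
Lemma period_contraction (R : realType) n (f : R -> 'cV[R]_n -> 'cV[R]_n)
    (N : 'cV[R]_n -> R) (C : set 'cV[R]_n) (T : R) (p : R -> R) :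
  0 < T -> C1_half_space f -> is_norm N -> convex_set C ->
  {within `[0, +oo[, continuous p} ->
  \int[lebesgue_measure]_(s in `[0, T]) p s < 0 ->
  (forall t z, 0 <= t -> C z -> log_norm N (Jacobian (f t) z) <= p t) ->
  exists c M, [/\ 0 < c, c < 1, 0 < M & forall z w,
    solution_in f C z -> solution_in f C w ->
    N (z T - w T) <= c * N (z 0 - w 0) /\
    forall t, 0 <= t -> t <= T -> N (z t - w t) <= M * N (z 0 - w 0)].
Proof.
move=> T0 fC1 NN Cconv pc pint mu_p.
have [P [Pc Pd P0 PT]] := integral_derivative T0 pc.
have [s sI Pmax] := EVT_max (ltW T0) Pc.
exists (expR (P T)), (expR (P s)); split; rewrite ?expR_gt0 ?expR_lt1 ?PT//.
move=> z w [zs zC] [ws wC].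
have H t : 0 <= t -> t <= T -> N (z t - w t) <= expR (P t) * N (z 0 - w 0).
  move=> t0 tT; have subT : `[0, t] `<=` `[(0 : R), T].
    by move=> r /=; rewrite !in_itv/= => /andP[-> rt]; exact: le_trans rt tT.
  have suby : `[0, t] `<=` `[(0 : R), +oo[.
    by move=> r /=; rewrite !in_itv/= andbT => /andP[].
  have := difference_gronwall NN t0 (continuous_subspaceW subT Pc) _
    (ode_solution_sub suby zs) (ode_solution_sub suby ws).
  rewrite P0 oppr0 expR0 mulr1 => /(_ p) K.
  rewrite mulrC -ler_pdivrMr ?expR_gt0// -expRN; apply: K => r /andP[r0 rt].
    by apply: Pd; rewrite r0 (lt_le_trans rt).
  apply: (one_sided_lipschitz fC1 NN Cconv r0).
  - by move=> y; apply: mu_p; exact: ltW.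
  - by apply: zC; exact: ltW.
  - by apply: wC; exact: ltW.
split=> [|t t0 tT]; first by rewrite -PT; apply: H => //; exact: ltW.
apply: le_trans (H t t0 tT) _; apply: ler_wpM2r; first by case: NN.
by rewrite ler_expR Pmax// in_itv/= t0.
Qed.

(** Translates by multiples of [T] are again solutions in [C], so the estimate
    over one period applies to each period in turn. *)
Lemma contraction_iter (R : realType) n (f : R -> 'cV[R]_n -> 'cV[R]_n)
    (N : 'cV[R]_n -> R) (C : set 'cV[R]_n) (T c M : R) :
  0 < T -> (forall t x, 0 <= t -> f (t + T) x = f t x) -> 0 < c -> 0 < M ->
  (forall z w, solution_in f C z -> solution_in f C w ->
    N (z T - w T) <= c * N (z 0 - w 0) /\
    forall t, 0 <= t -> t <= T -> N (z t - w t) <= M * N (z 0 - w 0)) ->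
  forall z w, solution_in f C z -> solution_in f C w ->
  forall k s, 0 <= s -> s <= T ->
  N (z (s + k%:R * T) - w (s + k%:R * T)) <= M * c ^+ k * N (z 0 - w 0).
Proof.
move=> T0 fT c0 M0 H z w zs ws k s s0 sT.
have step j : N (z (j%:R * T) - w (j%:R * T)) <= c ^+ j * N (z 0 - w 0).
  elim: j => [|j IH]; first by rewrite mul0r expr0 mul1r.
  have [Hj _] :=
    H _ _ (solution_in_shift j T0 fT zs) (solution_in_shift j T0 fT ws).
  have TE : T + j%:R * T = j.+1%:R * T by rewrite -natr1 mulrDl mul1r addrC.
  move: Hj; rewrite add0r TE => /le_trans; apply.
  by rewrite exprS -mulrA ler_pM2l.
have [_ Hk] :=
  H _ _ (solution_in_shift k T0 fT zs) (solution_in_shift k T0 fT ws).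
apply: le_trans (Hk s s0 sT) _.
by rewrite add0r -mulrA ler_pM2l.
Qed.

Lemma geometric_small (R : realType) (c B e : R) : 0 < c -> c < 1 -> 0 < e ->
  exists K : nat, forall k, (K <= k)%N -> B * c ^+ k < e.
Proof.
move=> c0 c1 e0; have B1 : 0 < `|B| + 1 by rewrite ltr_wpDl.
have c1' : `|c| < 1 by rewrite gtr0_norm.
have /cvgrPdist_lt/(_ _ (divr_gt0 e0 B1)) := cvg_expr c1'.
move=> [K _ KP]; exists K => k Kk; have := KP k Kk.
rewrite /= sub0r normrN gtr0_norm ?exprn_gt0// ltr_pdivlMr// mulrC.
apply: le_lt_trans; rewrite ler_pM2r ?exprn_gt0//.
by rewrite (le_trans (ler_norm B))// lerDl.
Qed.

Lemma solutions_in_merge (R : realType) n (f : R -> 'cV[R]_n -> 'cV[R]_n)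
    (N : 'cV[R]_n -> R) (C : set 'cV[R]_n) (T c M : R) :
  0 < T -> 0 < c -> c < 1 -> 0 < M ->
  (forall z w, solution_in f C z -> solution_in f C w ->
    forall k s, 0 <= s -> s <= T ->
    N (z (s + k%:R * T) - w (s + k%:R * T)) <= M * c ^+ k * N (z 0 - w 0)) ->
  forall z w, solution_in f C z -> solution_in f C w ->
  forall e, 0 < e -> exists t0, forall t, t0 <= t -> N (z t - w t) < e.
Proof.
move=> T0 c0 c1 M0 H z w zs ws e e0.
have [K KP] := geometric_small (M * N (z 0 - w 0)) c0 c1 e0.
exists (K.+1%:R * T) => t Kt.
have t0 : 0 <= t by apply: le_trans Kt; rewrite mulr_ge0// ltW.
have [k [s [s0 sT tE]]] := period_decomposition T0 t0.
have Kk : (K <= k)%N.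
  rewrite -ltnS -(ler_nat R) -(ler_pM2r T0) (le_trans Kt)// tE.
  by rewrite -[k.+1%:R]natr1 mulrDl mul1r addrC lerD2l.
rewrite tE; apply: le_lt_trans (H z w zs ws k s s0 sT) _.
by rewrite mulrAC; exact: KP.
Qed.

(** * The periodic limit solution *)

Lemma ode_mean_value (R : realType) n (f : R -> 'cV[R]_n -> 'cV[R]_n)
    (a b e : R) (u : R -> 'cV[R]_n) v : a <= b ->
  ode_solution f `[a, b] u ->
  (forall r, a < r < b -> `|f r (u r) - v| <= e) ->
  `|u b - u a - (b - a) *: v| <= e * (b - a).
Proof.
move=> ab us H.
have uc : {within `[a, b], continuous (fun r : R => u r - r *: v)}.
  move=> r; apply: cvgB; first exact: (ode_solution_continuous us).
  by apply: (@continuous_subspaceT _ _ _ (fun r : R => r *: v)) => s;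
    apply: cvgZr_tmp.
have ud r : a < r < b -> right_deriv (fun s => u s - s *: v) r (f r (u r) - v).
  move=> /andP[ar rb]; apply: right_derivB.
    by apply: ode_solution_right_deriv us _; rewrite ltW.
  apply/right_derivP => k k0; near=> h.
  rewrite scalerDl [r *: v + _]addrC addrK subrr normr0 mulr_ge0//.
  exact: ltW.
have := sublinear_mean_value (norm_sublinear _) ab uc ud H.
rewrite opprB [a *: v - _]addrC addrACA [- (b *: v) + _]addrC.
by rewrite -[a *: v - _]opprB -scalerBl.
Unshelve. all: by end_near. Qed.

(** For [s] close to [t] and [k] large, the arc of [u k] between [t] and [s]
    stays where [f] is close to [f t (x t)]: uniform convergence reduces this to the
    continuity of a single [u K].  The mean value inequality then bounds the
    difference quotients of [u k] uniformly in [k], and the bound passes to the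
    limit. *)
Lemma uniform_limit_solution (R : realType) n (f : R -> 'cV[R]_n -> 'cV[R]_n)
    (u : nat -> R -> 'cV[R]_n) (x : R -> 'cV[R]_n) :
  C1_half_space f -> (forall k, ode_solution f `[0, +oo[ (u k)) ->
  (forall e, 0 < e -> exists K, forall k t, (K <= k)%N -> 0 <= t ->
     `|x t - u k t| <= e) ->
  ode_solution f `[0, +oo[ x.
Proof.
move=> fC1 us ux; apply/ode_solutionP => t /= + e e0.
rewrite in_itv/= andbT => t0.
have [d0 d00 d0P] := C1_half_space_near (x t) fC1 t0 e0.
(* near_x below adds up four distances *)
have d5 : 0 < d0 / 5 by exact: divr_gt0.
have [K KP] := ux _ d5.
have /within_continuousP/(_ t _ _ d5) := ode_solution_continuous (us K).
rewrite /= in_itv/= andbT => /(_ t0)[d1 /= d10 d1P].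
exists (Num.min d0 d1); first by rewrite lt_min d00.
move=> s; rewrite in_itv/= andbT lt_min => s0 /andP[sd0 sd1].
have uK r : 0 <= r -> `|r - t| < d1 -> `|u K r - u K t| < d0 / 5.
  by move=> r0 rd; apply: d1P; rewrite /= ?in_itv/= ?r0// distrC.
have near_x k r : (K <= k)%N -> 0 <= r -> `|r - t| < d1 -> `|u k r - x t| < d0.
  move=> Kk r0 rd.
  have h1 := KP k r Kk r0; have h2 := KP K r (leqnn K) r0.
  have h3 := uK r r0 rd; have h4 := KP K t (leqnn K) t0.
  have -> : u k r - x t =
      - (x r - u k r) + (x r - u K r) + (u K r - u K t) - (x t - u K t).
    by rewrite !opprB !subrKA.
  apply: le_lt_trans (ler_normB _ _) _.
  apply: le_lt_trans (lerD (ler_normD _ _) (lexx _)) _.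
  apply: le_lt_trans (lerD (lerD (ler_normD _ _) (lexx _)) (lexx _)) _.
  rewrite normrN; lra.
have slope k : (K <= k)%N ->
    `|u k s - u k t - (s - t) *: f t (x t)| <= e * `|s - t|.
  move=> Kk.
  have f_near r : 0 <= r -> `|r - t| <= `|s - t| ->
      `|f r (u k r) - f t (x t)| <= e.
    move=> r0 rs; apply: ltW; apply: d0P => //; first exact: le_lt_trans sd0.
    by apply: near_x => //; exact: le_lt_trans sd1.
  have sub a b : 0 <= a -> `[a, b] `<=` `[(0 : R), +oo[.
    by move=> a0 r /=; rewrite !in_itv/= andbT => /andP[/(le_trans a0)].
  have [ts|st] := leP t s.
    rewrite ger0_norm ?subr_ge0//; apply: ode_mean_value => //.
      exact: ode_solution_sub (sub _ _ t0) (us k).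
    move=> r /andP[tr rs]; apply: f_near; first by rewrite (le_trans t0)// ltW.
    by rewrite !ger0_norm ?subr_ge0// ?lerD2r ltW.
  have -> : u k s - u k t - (s - t) *: f t (x t) =
      - (u k t - u k s - (t - s) *: f t (x t)).
    by rewrite -[s - t]opprB scaleNr opprK !opprB [RHS]addrC.
  rewrite normrN [`|s - t|]distrC gtr0_norm ?subr_gt0//.
  apply: ode_mean_value; first exact: ltW.
    exact: ode_solution_sub (sub _ _ s0) (us k).
  move=> r /andP[sr rt]; apply: f_near; first by rewrite (le_trans s0)// ltW.
  by rewrite distrC [`|s - t|]distrC !gtr0_norm ?subr_gt0// lerD2l lerN2 ltW.
apply/ler_addgt0Pr => e' e'0; have e2 : 0 < e' / 2 by exact: divr_gt0.
have [K' K'P] := ux _ e2; pose k := maxn K K'.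
have h1 := K'P k s (leq_maxr _ _) s0; have h2 := K'P k t (leq_maxr _ _) t0.
have h3 := slope k (leq_maxl _ _).
have -> : x s - x t - (s - t) *: f t (x t) = (x s - u k s) - (x t - u k t) +
    (u k s - u k t - (s - t) *: f t (x t)).
  by rewrite [RHS]addrA; congr (_ - _); rewrite opprB [RHS]addrAC !subrKA.
apply: le_trans (ler_normD _ _) _.
apply: le_trans (lerD (ler_normB _ _) (lexx _)) _; lra.
Qed.

Lemma compact_diameter (R : realType) n (N : 'cV[R]_n -> R) (C : set 'cV[R]_n) :
  is_norm N -> compact C ->
  exists2 D, 0 < D & forall x y, C x -> C y -> N (x - y) <= D.
Proof.
move=> NN /compact_bounded[B [_ BP]].
have [K [K0 _ _ NK]] := is_norm_sublinear NN.
have B1 : B < `|B| + 1 by rewrite (le_lt_trans (ler_norm B))// ltrDl.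
have B0 : 0 < `|B| + 1 by rewrite ltr_wpDl.
exists (K * ((`|B| + 1) + (`|B| + 1))); first by rewrite mulr_gt0// addr_gt0.
move=> x y Cx Cy; apply: le_trans (NK _) _; rewrite ler_pM2l//.
apply: le_trans (ler_normB _ _) _; apply: lerD.
  exact: (BP _ B1 x Cx).
exact: (BP _ B1 y Cy).
Qed.

(** The translates [u k] of [x] by [k] periods form a Cauchy sequence, uniformly
    in time: [u m] and [u k] are the translates by [k] periods of [u (m - k)]
    and [u 0], two solutions in [C] with initial values at most [diam C] apart. *)
Lemma periodic_limit (R : realType) n (f : R -> 'cV[R]_n -> 'cV[R]_n)
    (N : 'cV[R]_n -> R) (C : set 'cV[R]_n) (T c M : R) x :
  C1_half_space f -> is_norm N -> compact C ->
  0 < T -> (forall t x, 0 <= t -> f (t + T) x = f t x) ->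
  0 < c -> c < 1 -> 0 < M ->
  (forall z w, solution_in f C z -> solution_in f C w ->
    forall k s, 0 <= s -> s <= T ->
    N (z (s + k%:R * T) - w (s + k%:R * T)) <= M * c ^+ k * N (z 0 - w 0)) ->
  solution_in f C x ->
  exists2 xs, solution_in f C xs & periodic_on_nneg T xs.
Proof.
move=> fC1 NN Ccompact T0 fT c0 c1 M0 H xsol.
have [D D0 DP] := compact_diameter NN Ccompact.
have [b b0 bP] := is_norm_dominates NN.
pose u k t := x (t + k%:R * T).
have usol k : solution_in f C (u k) := solution_in_shift k T0 fT xsol.
have uS k t : u k (t + T) = u k.+1 t.
  by rewrite /u -[k.+1%:R]nat1r mulrDl mul1r addrA.
pose B := b * (M * D).
have u_dist k m t : (k <= m)%N -> 0 <= t -> `|u m t - u k t| <= B * c ^+ k.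
  move=> km t0; have [j [s [s0 sT ->]]] := period_decomposition T0 t0.
  have uE i : u (k + i)%N (s + j%:R * T) = u i (s + (j + k)%:R * T).
    rewrite /u -!addrA -!mulrDl -!natrD.
    by congr (x (_ + _%:R * T)); rewrite !addnA.
  have -> : u k (s + j%:R * T) = u 0%N (s + (j + k)%:R * T).
    by rewrite -uE addn0.
  rewrite -(subnKC km) uE; apply: le_trans (bP _) _.
  rewrite /B -mulrA ler_pM2l//.
  apply: le_trans (H _ _ (usol _) (usol _) _ _ s0 sT) _.
  rewrite -!mulrA ler_pM2l// mulrC; apply: ler_pM.
  - by case: NN.
  - by rewrite exprn_ge0// ltW.
  - by apply: DP; apply: (usol _).2.
  have [c_ge0 c_le1] := (ltW c0, ltW c1).
  by rewrite exprD ler_piMl ?exprn_ge0 ?exprn_ile1.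
have B_small e : 0 < e ->
    exists K : nat, forall k, (K <= k)%N -> B * c ^+ k < e.
  exact: geometric_small.
pose xs t := lim (u k t @[k --> \oo]).
have u_cvg t : 0 <= t -> u k t @[k --> \oo] --> xs t.
  move=> t0; apply: cauchy_cvg; apply: cauchy_exP => e e0.
  have [K KP] := B_small e e0; exists (u K t); exists K => // k /= Kk.
  rewrite -ball_normE /ball_/= distrC.
  by apply: le_lt_trans (KP K _); rewrite ?u_dist.
have xs_dist k t : 0 <= t -> `|xs t - u k t| <= B * c ^+ k.
  move=> t0; apply/ler_addgt0Pl => e e0.
  have /cvgrPdist_lt/(_ e e0)[K _ KP] := u_cvg t t0.
  have := KP (maxn K k) (leq_maxl _ _).
  have := u_dist k (maxn K k) t (leq_maxr _ _) t0.
  set m := maxn K k => h1 h2.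
  have -> : xs t - u k t = (xs t - u m t) + (u m t - u k t) by rewrite subrKA.
  by apply: le_trans (ler_normD _ _) _; apply: lerD => //; exact: ltW.
exists xs.
  split.
    apply: (uniform_limit_solution fC1 (fun k => (usol k).1)) => e e0.
    have [K KP] := B_small e e0; exists K => k t Kk t0.
    by apply: le_trans (xs_dist k t t0) _; apply: ltW; exact: KP.
  move=> t t0; apply: (closed_cvg C _ _ _ (u_cvg t t0)).
    by apply: compact_closed => //; exact: norm_hausdorff.
  by near=> k; apply: (usol k).2.
move=> t t0; rewrite /xs.
under eq_fun do rewrite uS.
have := u_cvg t t0; rewrite -(cvg_shiftS (fun k => u k t)).
by move=> /cvg_lim; apply; exact: norm_hausdorff.
Unshelve. all: by end_near. Qed.

Theorem theorem2 (R : realType) (n : nat) (T : R)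
    (f : R -> 'cV[R]_n -> 'cV[R]_n) (S C : set 'cV[R]_n)
    (N : 'cV[R]_n -> R) (p : R -> R)
    (T_gt0 : 0 < T)
    (f_C1 : C1_half_space f)
    (f_periodic : forall t x, 0 <= t -> f (t + T) x = f t x)
    (S_nonempty : S !=set0)
    (C_convex : convex_set C)
    (C_compact : compact C)
    (S_to_C : forall t0 x0, 0 <= t0 -> S x0 ->
       exists2 tau, t0 <= tau &
         forall t, tau <= t -> flow_defined f t t0 x0 /\ C (flow f t t0 x0))
    (N_norm : is_norm N)
    (p_periodic : periodic_on_nneg T p)
    (p_continuous : {within `[0, +oo[, continuous p})
    (p_integral : \int[lebesgue_measure]_(s in `[0, T]) p s < 0)
    (mu_le_p : forall t z, 0 <= t -> C z ->
       log_norm N (Jacobian (f t) z) <= p t) :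
  exists xs : R -> 'cV[R]_n,
    [/\ periodic_solution_in f T C xs,
        forall t0 x0, 0 <= t0 -> S x0 ->
          N (flow f t t0 x0 - xs t) @[t --> +oo] --> 0
      & forall y : R -> 'cV[R]_n, periodic_solution_in f T C y ->
          forall t, 0 <= t -> y t = xs t].
Proof.
have [c [M [c0 c1 M0 contr]]] :=
  period_contraction T_gt0 f_C1 N_norm C_convex p_continuous p_integral mu_le_p.
have iter := contraction_iter T_gt0 f_periodic c0 M0 contr.
have merge := solutions_in_merge T_gt0 c0 c1 M0 iter.
have flow_in t0 x0 : 0 <= t0 -> S x0 ->
    exists k : nat, solution_in f C (fun t => flow f (t + k%:R * T) t0 x0).
  move=> t00 Sx0; have [tau t0tau tauP] := S_to_C t0 x0 t00 Sx0.
  have tau0 : 0 <= tau by exact: le_trans t0tau.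
  have [k [s [s0 sT tauE]]] := period_decomposition T_gt0 tau0.
  have tau_le t : 0 <= t -> tau <= t + k.+1%:R * T.
    move=> t_ge0; rewrite tauE -[k.+1%:R]nat1r mulrDl mul1r addrA.
    by rewrite lerD2r (le_trans sT)// lerDr.
  exists k.+1; split=> [|t t_ge0]; last by apply: (tauP _ (tau_le t t_ge0)).2.
  have := flow_solution f_C1 T_gt0 f_periodic t00 (fun t h => (tauP t h).1).
  apply: ode_solution_shift => t /=; rewrite !in_itv/= !andbT.
    by move=> t_ge0; exact: le_trans t0tau (tau_le t t_ge0).
  move=> y t_ge0; apply: (@periodic_mul _ _ T (f^~ y)) => // r r0.
  exact: f_periodic.
have [x0 Sx0] := S_nonempty; have [k0 x_sol] := flow_in 0 x0 (lexx 0) Sx0.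
have [xs xs_sol xs_per] :=
  periodic_limit f_C1 N_norm C_compact T_gt0 f_periodic c0 c1 M0 iter x_sol.
exists xs; split.
- by split=> // [|t /andP[t0 _]]; [exact: xs_sol.1|exact: xs_sol.2].
- move=> t0 y0 t00 Sy0; have [k y_sol] := flow_in t0 y0 t00 Sy0.
  apply/cvgrPdist_lt => /= e e0; have [r rP] := merge _ _ y_sol xs_sol e e0.
  have Npos v : 0 <= N v by case: N_norm.
  near=> t; rewrite sub0r normrN ger0_norm//.
  have tk : 0 <= t - k%:R * T.
    by rewrite subr_ge0; near: t; apply: nbhs_pinfty_ge; rewrite num_real.
  have := rP (t - k%:R * T).
  rewrite subrK -(periodic_mul k T_gt0 xs_per tk) subrK.
  by apply; rewrite lerBrDr; near: t; apply: nbhs_pinfty_ge; rewrite num_real.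
move=> y [ysol yper yC] t t0.
have y_in : solution_in f C y.
  split=> // r r0; have [k [s [s0 sT ->]]] := period_decomposition T_gt0 r0.
  by rewrite (periodic_mul k T_gt0 yper s0); apply: yC; rewrite s0.
have [N0 N0eq _ _] := N_norm.
apply/eqP; rewrite -subr_eq0; apply/eqP/N0eq/le_anti/andP; split=> //.
apply/ler_addgt0Pr => e e0; rewrite add0r.
have [r rP] := merge _ _ y_in xs_sol e e0.
have [k rk] : exists k : nat, r <= t + k%:R * T.
  have [k [s [s0 sT rE]]] := period_decomposition T_gt0 (normr_ge0 r).
  exists k.+1; rewrite (le_trans (ler_norm r))// rE.
  rewrite -[k.+1%:R]nat1r mulrDl mul1r.
  by rewrite addrA lerD2r (le_trans sT)// lerDr.
(* the distance between y and xs is periodic *)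
by have := rP _ rk; rewrite !periodic_mul// => /ltW.
Unshelve. all: by end_near. Qed.
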